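(* Suppose Assumptions 1 and 2 (stated in the context) hold, with tail index $\alpha<1.5$. Then, for given $b>0$, there does not exist an assignment of $(p_k,n_k:k\ge1)$ such that both $\mathbb{E}^Q[Z^2(b)]$ and $\mathbb{E}^Q[\nu_b]$ are simultaneously finite.
   Context: $X,X_1,X_2,\dots$ are i.i.d. real random variables with distribution function $F$, $\mathbb{E}X=0$, under a probability measure $\mathbb{P}$; $S_0=0$, $S_n=X_1+\dots+X_n$. Fix $\mu>0$. For $b>0$, $\tau_b:=\inf\{n\ge0: S_n-n\mu>b\}$. Assumption 1: $\bar F(x):=\mathbb{P}\{X>x\}=x^{-\alpha}L(x)$ for some $\alpha>1$ and some slowly varying $L$ (i.e. $L(tx)/L(x)\to1$ as $x\to\infty$ for every $t>0$). Further, if $\mathrm{Var}[X]=\infty$, then $\limsup_{x\to\infty}\mathbb{P}\{X<-x\}/\mathbb{P}\{X>x\}<\infty$. Assumption 2: there is $t_0>0$ such that $L$ is continuously differentiable on $[t_0,\infty)$, and $L'(x)=o(L(x)/x)$ as $x\nearrow\infty$. An assignment $(p_k,n_k:k\ge1)$ consists of a strictly increasing sequence of integers $(n_k)_{k\ge0}$ with $n_0=0$ and numbers $p_k>0$ with $\sum_{k\ge1}p_k=1$ (both allowed to depend on $b$). Given such an assignment let $q_k(b):=\sum_{i=n_{k-1}+1}^{n_k}\bar F(b+i\mu)$. Events: $A_k=\bigcup_{i=n_{k-1}+1}^{n_k}\{X_i>b+i\mu\}$, $B_k=\bigcap_{i=1}^{n_k}\{X_i<b+n_{k-1}\mu\}$;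 bars denote complements. Measure $\mathbb{P}_{k,1}$: choose $J\in\{n_{k-1}+1,\dots,n_k\}$ with $\Pr\{J=n\}=\bar F(b+n\mu)/q_k(b)$; then generate independently $X_n$, $n\le n_k$, from $F(\cdot\mid X_n\ge b+n\mu)$ if $n=J$ and from $F$ otherwise. Estimator: $$Z_{k,1}(b):=\frac{q_k(b)}{\#\{n_{k-1}<i\le n_k: X_i\ge b+i\mu\}}\mathbb{I}(n_{k-1}<\tau_b\le n_k,\ A_k).$$ Measure $\mathbb{P}_{k,2}$: let $\theta_k:=\frac{-\log(n_k\bar F(b+n_{k-1}\mu))}{b+n_{k-1}\mu}$ and $\Lambda_k(\theta):=\log\int_{-\infty}^{b+n_{k-1}\mu}e^{\theta x}F(dx)$ (only assignments for which $\Lambda_k(\theta_k)$ is finite for all $k$ are considered, so that the measure is defined). Generate $X_1,\dots,X_{\tau_b\wedge n_k}$ independently from $F_k$, where $\frac{dF_k(x)}{dF(x)}=\exp(\theta_kx-\Lambda_k(\theta_k))\mathbf 1(x<b+n_{k-1}\mu)$; the remaining increments up to index $n_k$ have law $F$ independently. Estimator: $$Z_{k,2}(b):=\exp(-\theta_kS_{\tau_b}+\tau_b\Lambda_k(\theta_k))\,\mathbb{I}(n_{k-1}<\tau_b\le n_k,\ B_k).$$ Measure $\mathbb{P}_{k,3}$: choose $J$ uniformly from $\{1,\dots,n_k\}$; generate independently $X_n$, $n\le n_k$, from $F(\cdot\mid X_n\ge b+n_{k-1}\mu)$ if $n=J$ and from $F$ otherwise. Estimator: $$Z_{k,3}(b):=\frac{n_k\bar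 F(b+n_{k-1}\mu)}{\#\{1\le i\le n_k: X_i\ge b+n_{k-1}\mu\}}\mathbb{I}(n_{k-1}<\tau_b\le n_k,\ \bar A_k\cap\bar B_k).$$ $Z_k(b):=Z_{k,1}(b)+Z_{k,2}(b)+Z_{k,3}(b)$, with the three summands generated independently under $\mathbb{P}_{k,1},\mathbb{P}_{k,2},\mathbb{P}_{k,3}$ respectively; it is an unbiased estimator of $\mathbb{P}\{n_{k-1}<\tau_b\le n_k\}$. Overall estimator: draw $K$ with $\Pr\{K=k\}=p_k$; given $K=k$ generate $Z_{k,1}(b),Z_{k,2}(b),Z_{k,3}(b)$ independently under $\mathbb{P}_{k,1},\mathbb{P}_{k,2},\mathbb{P}_{k,3}$ respectively and form their sum $Z_k(b)$; set $Z(b):=Z_K(b)/p_K$, an unbiased estimator of $\mathbb{P}\{\tau_b<\infty\}$. $Q$ is the probability measure induced by this procedure and $\mathbb{E}^Q$ its expectation. $\nu_b$ denotes the largest index of the increment random variables considered for simulation in a run; since the procedure generates $X_1,\dots,X_{n_K}$ and none with larger index, $\nu_b=n_K$. *)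

(* Defs.v *)
From HB Require Import structures.
From mathcomp Require Import all_boot all_order all_algebra.
From mathcomp Require Import all_classical all_reals all_analysis measurable_realfun.
Set Implicit Arguments.
Unset Strict Implicit.
Unset Printing Implicit Defensive.
Import Order.TTheory GRing.Theory Num.Theory.
Import numFieldNormedType.Exports.
Local Open Scope classical_set_scope.
Local Open Scope ring_scope.

Definition slowly_varying (R : realType) (L : R -> R) : Prop :=
  forall t : R, 0 < t -> L (t * x) / L x @[x --> +oo] --> (1 : R).

Section assumptions.
Context d (Omega : measurableType d) (R : realType) (P : probability Omega R).
Variables (X : {RV P >-> R}) (alpha : R) (L : R -> R).

(* The quotient below may be junk for small x only: L is eventually nonzero. *)
Definition tail_assumption : Prop :=
  [/\ 1 < alpha, slowly_varying L,
      forall x : R, 0 < x -> ccdf X x = (x `^ (- alpha) * L x)%:E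
    & ('V_P[X] = +oo ->
       limf_esup (fun x : R => (fine (P [set w | X w < - x]%R) /
                                fine (P [set w | X w > x]%R))%:E)
                 (pinfty_nbhs R) < +oo)%E].

Definition smoothness_assumption : Prop :=
  (exists2 t0 : R, 0 < t0 &
    {in `[t0, +oo[, forall x, derivable L x 1} /\
    {within `[t0, +oo[, continuous L^`()%classic}) /\
  (forall eps : R, 0 < eps ->
     \forall x \near +oo, `|L^`()%classic x| <= eps * `|L x / x|).

End assumptions.

Section law_combinators.
Context (R : realType).
Local Open Scope ereal_scope.

(* F( . | A); the fallback value F is taken only when F A = 0. *)
Definition cond_law (F : probability R R) (A : set R) (mA : measurable A) :
    probability R R :=
  mnormalize (mrestr F mA) F.

Lemma cond_lawE (F : probability R R) (A : set R) (mA : measurable A) B :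
  F A != 0 -> cond_law F mA B = F (B `&` A) * (fine (F A))^-1%:E.
Proof.
have FT : mrestr F mA setT = F A by rewrite /mrestr setTI.
move=> FA0; rewrite /cond_law/= /mnormalize/= FT (negbTE FA0)/= ifF//.
by apply/negbTE; rewrite lt_eqF// ltey_eq fin_num_measure.
Qed.

Section exponential_tilting.
Variables (F : probability R R) (theta c : R).

(* The range of integration excludes c: this is what makes tilt_density below
   integrate to 1 when F has an atom at c. *)
Definition log_mgf_below : \bar R :=
  lne (\int[F]_(x in `]-oo, c[) (expR (theta * x))%:E).

Definition tilt_density (x : R) : R :=
  (expR (theta * x - fine log_mgf_below) * (x < c)%R%:R)%R.

Definition tilt_measure (A : set R) : \bar R :=
  \int[F]_(x in A) (tilt_density x)%:E.

Let tilt_density_ge0 x : (0 <= tilt_density x)%R.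
Proof. by rewrite mulr_ge0 ?expR_ge0. Qed.

Let measurable_tilt_density : measurable_fun setT tilt_density.
Proof.
have mg : measurable_fun [set: R] (fun x => theta * x - fine log_mgf_below)%R.
  by apply: (@measurable_funB _ R R) => //; exact: (@measurable_funM _ R R).
have mlt : measurable_fun [set: R] (fun x => (x < c)%R).
  by apply: (@measurable_fun_ltr _ R R).
have mb : measurable_fun [set: bool] (fun e : bool => e%:R : R) by [].
exact: (measurable_funM (measurableT_comp (@measurable_expR R) mg)
                        (measurableT_comp mb mlt)).
Qed.

Let tilt0 : tilt_measure set0 = 0.
Proof. by rewrite /tilt_measure integral_set0. Qed.

Let tilt_ge0 A : 0 <= tilt_measure A.
Proof. by apply: integral_ge0 => x _; rewrite lee_fin. Qed.

Let tilt_sigma_additive : semi_sigma_additive tilt_measure.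
Proof.
move=> B mB tB mUB; rewrite /tilt_measure; apply: cvg_toP.
  apply: ereal_nondecreasing_is_cvgn => m n mn.
  apply: lee_sum_nneg_natr => // k _ _; apply: integral_ge0 => /= x _.
  by rewrite lee_fin.
rewrite ge0_integral_bigcup//=.
- by apply/measurable_EFinP; apply: measurable_funTS.
- by move=> x _; rewrite lee_fin.
Qed.

HB.instance Definition _ :=
  isMeasure.Build _ _ _ tilt_measure tilt0 tilt_ge0 tilt_sigma_additive.

(* dF_theta/dF = exp(theta x - Lambda(theta)) 1(x < c). Normalization, with
   fallback F, only serves to have a probability measure when log_mgf_below is
   infinite. *)
Definition tilt_law : probability R R := mnormalize tilt_measure F.

Lemma tilt_lawE A : log_mgf_below \is a fin_num ->
  tilt_law A = \int[F]_(x in A) (tilt_density x)%:E.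
Proof.
move=> Lfin; suff T1 : tilt_measure setT = 1.
  rewrite /tilt_law/= /mnormalize/= T1/= ifF ?invr1 ?mule1//.
  by rewrite onee_eq0.
have mE : measurable_fun [set: R] (fun x => (expR (theta * x))%:E).
  have mg : measurable_fun [set: R] (fun x => theta * x)%R.
    exact: (@measurable_funM _ R R).
  have me := measurableT_comp (@measurable_expR R) mg.
  exact: (measurableT_comp (@EFin_measurable R setT) me).
rewrite /tilt_measure.
transitivity (\int[F]_(x in `]-oo, c[)
    ((expR (- fine log_mgf_below))%:E * (expR (theta * x))%:E)).
  rewrite [RHS]integral_mkcond; apply: eq_integral => x _.
  rewrite patchE /tilt_density mem_setE in_itv/=.
  by case: ifP => _; rewrite ?mulr0// mulr1 addrC expRD.
have mD : measurable_fun `]-oo, c[%classic (fun x => (expR (theta * x))%:E).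
  exact: measurable_funTS mE.
have e0 x : `]-oo, c[%classic x -> 0 <= (expR (theta * x))%:E.
  by rewrite lee_fin expR_ge0.
rewrite (ge0_integralZl _ _ mD e0) ?lee_fin ?expR_ge0//.
have I0 : 0 <= \int[F]_(x in `]-oo, c[) (expR (theta * x))%:E.
  by apply: integral_ge0 => x _; rewrite lee_fin expR_ge0.
move: Lfin; rewrite /log_mgf_below.
case: (\int[F]_(x in _) _) I0 => [r| |//] //.
rewrite lee_fin => r_ge0; have [r0|r0] := ltP 0%R r; last first.
  by rewrite le0_lneNy ?lee_fin.
by rewrite lne_EFin//= => _; rewrite -EFinM expRN lnK ?posrE// mulVf ?gt_eqF.
Qed.

End exponential_tilting.

Definition cons_pair n (z : R * n.-tuple R) : n.+1.-tuple R :=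
  [tuple of z.1 :: z.2].

Lemma measurable_cons_pair n : measurable_fun setT (@cons_pair n).
Proof. exact: measurable_cons. Qed.

HB.instance Definition _ n :=
  isMeasurableFun.Build _ _ _ _ (@cons_pair n) (@measurable_cons_pair n).

(* Independent coordinates, the one of index i (counted from 0) having law m i. *)
Fixpoint indep_law n (m : nat -> probability R R) : probability (n.-tuple R) R :=
  match n with
  | 0 => \d_([tuple] : 0.-tuple R)
  | n'.+1 => distribution (m 0%N \x indep_law n' (m \o S)) (@cons_pair n')
  end.

(* Draw an index j from s with probability w j, then a point from m j. *)
Section mixture.
Context d (T : measurableType d).
Variables (s : seq nat) (w : nat -> {nonneg R}) (m : nat -> probability T R).

Definition mixture (A : set T) := \sum_(j <- s) (w j)%:num%:E * m j A.

Let mixtureE : mixture = msum (fun i => mscale (w (nth 0%N s i)) (m (nth 0%N s i))) (size s).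
Proof.
by apply/funext => A; rewrite /mixture (big_nth 0%N) big_mkord.
Qed.

Let mixture0 : mixture set0 = 0.
Proof. by rewrite mixtureE measure0. Qed.

Let mixture_ge0 A : 0 <= mixture A.
Proof. by rewrite mixtureE measure_ge0. Qed.

Let mixture_sigma_additive : semi_sigma_additive mixture.
Proof. by rewrite mixtureE; exact: measure_semi_sigma_additive. Qed.

HB.instance Definition _ :=
  isMeasure.Build _ _ _ mixture mixture0 mixture_ge0 mixture_sigma_additive.

Let mixture_fin : fin_num_fun mixture.
Proof.
move=> A mA; rewrite /mixture; apply/sum_fin_numP => j _ _.
by rewrite fin_numM// fin_num_measure.
Qed.

HB.instance Definition _ := Measure_isFinite.Build _ _ _ mixture mixture_fin.
End mixture.

Lemma mixture_setT d (T : measurableType d) (s : seq nat) (w : nat -> {nonneg R})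
    (m : nat -> probability T R) :
  mixture s w m setT = (\sum_(j <- s) (w j)%:num)%R%:E.
Proof.
rewrite /mixture -sumEFin; apply: eq_bigr => j _.
by rewrite probability_setT mule1.
Qed.

End law_combinators.

(* The simulated increments are the entries of a finite sequence x, entry
   number i - 1 being the i-th increment. *)
Section random_walk.
Context (R : realType).
Variables (mu b : R).

Definition increment (x : seq R) (i : nat) : R := nth 0 x i.-1.

Definition walk (x : seq R) (n : nat) : R :=
  \sum_(1 <= i < n.+1) increment x i.

(* The least n <= size x with walk x n - n mu > b, and (size x).+1 if none. *)
Definition tau (x : seq R) : nat :=
  find (fun n => b < walk x n - n%:R * mu) (iota 0 (size x).+1).

(* The increments of y up to time tau y, followed by those of z. *)
Definition splice n (yz : n.-tuple R * n.-tuple R) : n.-tuple R :=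
  [tuple if (i < tau yz.1)%N then tnth yz.1 i else tnth yz.2 i | i < n].

Lemma measurable_increment n i :
  measurable_fun [set: n.-tuple R] (fun x : n.-tuple R => increment x i).
Proof.
rewrite /increment; have [lti|nlei] := ltnP i.-1 n.
  rewrite (_ : (fun x => _) = fun x : n.-tuple R => tnth x (Ordinal lti)).
    exact: measurable_tnth.
  by apply/funext => x; rewrite (tnth_nth 0).
rewrite (_ : (fun x => _) = cst 0)//.
by apply/funext => x; rewrite nth_default// size_tuple.
Qed.

Lemma measurable_walk n m :
  measurable_fun [set: n.-tuple R] (fun x : n.-tuple R => walk x m).
Proof. by apply: measurable_sum => i; exact: measurable_increment. Qed.

Lemma measurable_lt_tau n i : (i <= n)%N ->
  measurable_fun [set: n.-tuple R] (fun x : n.-tuple R => (i < tau x)%N).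
Proof.
move=> ilen; pose p m (x : n.-tuple R) := b < walk x m - m%:R * mu.
rewrite (_ : (fun x => _) =
    fun x : n.-tuple R => ~~ has (p ^~ x) (iota 0 i.+1)); last first.
  apply/funext => x; rewrite ltnNge -ltnS -has_take_leq ?size_iota ?size_tuple//.
  by rewrite take_iota (minn_idPl _).
apply: measurable_neg; elim: (iota _ _) => [|m s IHs]/=; first exact: measurable_cst.
apply: measurable_or => //; apply: measurable_fun_ltr => //.
by apply: measurable_funB => //; exact: measurable_walk.
Qed.

Lemma measurable_splice n : measurable_fun setT (@splice n).
Proof.
apply/measurable_fun_tnthP => i.
rewrite (_ : _ \o _ = fun yz : n.-tuple R * n.-tuple R =>
  if (i < tau yz.1)%N then tnth yz.1 i else tnth yz.2 i); last first.
  by apply/funext => yz /=; rewrite tnth_mktuple.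
apply: measurable_fun_ifT => /=.
- exact: (measurableT_comp (measurable_lt_tau (ltnW (ltn_ord i)))).
- exact: (measurableT_comp (measurable_tnth i)).
- exact: (measurableT_comp (measurable_tnth i)).
Qed.

HB.instance Definition _ n :=
  isMeasurableFun.Build _ _ _ _ (@splice n) (@measurable_splice n).

End random_walk.

(* Only prob k with 0 < k is used. *)
Record assignment (R : realType) := Assignment {
  prob : nat -> {posnum R};
  prob_sum : (\sum_(1 <= k <oo) (prob k)%:num%:E = 1)%E;
  idx : nat -> nat;
  idx0 : idx 0%N = 0%N;
  idx_incr : {homo idx : i j / (i < j)%N}
}.

(* For k >= 1, the k-th piece {n_(k-1) < tau <= n_k} with n = idx a, lo = n_(k-1)
   and hi = n_k. law1, law2, law3 are the laws of (X_1, ..., X_(n_k)) under the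
   three sampling measures; in law1 and law3 the random index J is averaged out. *)
Section estimators.
Context (R : realType).
Variables (F : probability R R) (mu b : R) (a : assignment R) (k : nat).

Definition tail (x : R) : R := fine (F `]x, +oo[%classic).
Definition level (i : nat) : R := b + i%:R * mu.

Local Notation lo := (idx a k.-1).
Local Notation hi := (idx a k).

Definition window : seq nat := index_iota lo.+1 hi.+1.
Definition upto : seq nat := index_iota 1 hi.+1.

Definition q : R := \sum_(i <- window) tail (level i).
Definition theta : R := - ln (hi%:R * tail (level lo)) / level lo.
Definition Lambda : \bar R := log_mgf_below F theta (level lo).

Definition hits_in_window (x : seq R) : bool := (lo < tau mu b x <= hi)%N.
Definition in_A (x : seq R) : bool :=
  has (fun i => level i < increment x i) window.
Definition in_B (x : seq R) : bool :=
  all (fun i => increment x i < level lo) upto.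

Definition Z1 (x : seq R) : R :=
  q / (count (fun i => level i <= increment x i) window)%:R
  * (hits_in_window x && in_A x)%:R.

Definition Z2 (x : seq R) : R :=
  expR (- theta * walk x (tau mu b x) + (tau mu b x)%:R * fine Lambda)
  * (hits_in_window x && in_B x)%:R.

Definition Z3 (x : seq R) : R :=
  hi%:R * tail (level lo)
  / (count (fun i => level lo <= increment x i) upto)%:R
  * [&& hits_in_window x, ~~ in_A x & ~~ in_B x]%:R.

Lemma tail_ge0 x : 0 <= tail x.
Proof. exact: fine_ge0. Qed.

Lemma q_ge0 : 0 <= q.
Proof. by apply: sumr_ge0 => i _; exact: tail_ge0. Qed.

Definition above (c : R) : probability R R :=
  cond_law F (measurable_itv `[c, +oo[).

Definition J1_weight (j : nat) : {nonneg R} :=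
  NngNum (divr_ge0 (tail_ge0 (level j)) q_ge0).

Definition law1 : {finite_measure set (hi.-tuple R) -> \bar R} :=
  mixture window J1_weight (fun j => indep_law hi
    (fun i => if i.+1 == j then above (level j) else F)).

Definition law2 : probability (hi.-tuple R) R :=
  distribution
    (indep_law hi (fun=> tilt_law F theta (level lo)) \x indep_law hi (fun=> F))%E
    (@splice R mu b hi).

Definition J3_weight (j : nat) : {nonneg R} := (hi%:R^-1)%:nng.

Definition law3 : {finite_measure set (hi.-tuple R) -> \bar R} :=
  mixture upto J3_weight (fun j => indep_law hi
    (fun i => if i.+1 == j then above (level lo) else F)).

End estimators.

(* A run of the procedure: the value k of K together with the three vectors of
   length n k generated given K = k. *)
Notation runs R n := (n.-tuple R * n.-tuple R * n.-tuple R)%type.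

Definition outcome (R : realType) (n : nat -> nat) : Type :=
  {k : nat & runs R (n k)}.

Section outcome_measurable.
Context (R : realType) (n : nat -> nat).

HB.instance Definition _ := Choice.on (outcome R n).
HB.instance Definition _ :=
  isPointed.Build (outcome R n) (existT _ 0%N (point : runs R (n 0%N))).

Definition run_of (k : nat) (w : runs R (n k)) : outcome R n := existT _ k w.

(* The sum sigma-algebra. *)
Definition outcome_measurable : set (set (outcome R n)) :=
  [set A | forall k, measurable (@run_of k @^-1` A)].

Let outcome0 : outcome_measurable set0.
Proof. by move=> k; rewrite preimage_set0. Qed.

Let outcomeC A : outcome_measurable A -> outcome_measurable (~` A).
Proof. by move=> mA k; rewrite preimage_setC; exact: (measurableC (mA k)). Qed.

Let outcome_bigcup (A : (set (outcome R n))^nat) :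
  (forall i, outcome_measurable (A i)) -> outcome_measurable (\bigcup_i A i).
Proof.
move=> mA k; rewrite preimage_bigcup; apply: bigcupT_measurable => i.
exact: mA.
Qed.

HB.instance Definition _ := isMeasurable.Build default_measure_display
  (outcome R n) outcome0 outcomeC outcome_bigcup.

Lemma measurable_run_of k : measurable_fun setT (@run_of k).
Proof. by move=> _ A mA; rewrite setTI; exact: mA. Qed.

HB.instance Definition _ k :=
  isMeasurableFun.Build _ _ _ _ (@run_of k) (@measurable_run_of k).

End outcome_measurable.

Section overall.
Context (R : realType).
Variables (F : probability R R) (mu b : R) (a : assignment R).
Local Open Scope ereal_scope.

Definition run_law (k : nat) : {measure set (runs R (idx a k)) -> \bar R} :=
  law1 F mu b a k \x law2 F mu b a k \x law3 F mu b a k.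

(* The law of the run conditionally on K = k. *)
Definition law_given (k : nat) (A : set (outcome R (idx a))) : \bar R :=
  run_law k (@run_of R (idx a) k @^-1` A).

Section law_given_measure.
Variable k : nat.

Let law_given0 : law_given k set0 = 0.
Proof. by rewrite /law_given preimage_set0 measure0. Qed.

Let law_given_ge0 A : 0 <= law_given k A.
Proof. exact: measure_ge0. Qed.

Let law_given_sigma_additive : semi_sigma_additive (law_given k).
Proof.
apply: (@measure_semi_sigma_additive _ _ _
  (pushforward (run_law k) (@run_of R (idx a) k) : {measure set _ -> \bar R})).
exact: measurable_run_of.
Qed.

HB.instance Definition _ := isMeasure.Build _ _ _ (law_given k)
  law_given0 law_given_ge0 law_given_sigma_additive.
End law_given_measure.

Definition Q : {measure set (outcome R (idx a)) -> \bar R} :=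
  mseries (fun k => mscale ((prob a k)%:num%:nng)%R (law_given k)) 1.

Definition Z (w : outcome R (idx a)) : R :=
  let: existT k (x1, x2, x3) := w in
  ((Z1 F mu b a k x1 + Z2 F mu b a k x2 + Z3 F mu b a k x3)
   / (prob a k)%:num)%R.

(* The largest index of a simulated increment. *)
Definition nu (w : outcome R (idx a)) : nat := idx a (projT1 w).

End overall.

Section total_mass.
Context (R : realType).
Variables (F : probability R R) (mu b : R) (a : assignment R).
Local Open Scope ereal_scope.

Lemma run_law_setT k : (0 < k)%N -> (forall x, 0 < tail F x)%R ->
  run_law F mu b a k setT = 1.
Proof.
move=> k0 F0; have hi0 : (0 < idx a k)%N.
  by have := idx_incr a k0; rewrite idx0.
have lohi : (idx a k.-1 < idx a k)%N by apply: (idx_incr a); rewrite prednK.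
have q0 : (0 < q F mu b a k)%R.
  rewrite /q /window big_nat_recr//= ltr_wpDl// sumr_ge0// => i _.
  exact: tail_ge0.
have law1T : law1 F mu b a k setT = 1.
  by apply: (etrans (mixture_setT _ _ _)); rewrite /= -mulr_suml divff ?gt_eqF.
have law3T : law3 F mu b a k setT = 1.
  apply: (etrans (mixture_setT _ _ _)); rewrite /= /upto big_const_nat subn1/= iter_addr addr0.
  by rewrite -mulr_natr mulVf// pnatr_eq0 -lt0n.
transitivity ((law1 F mu b a k \x law2 F mu b a k \x law3 F mu b a k)
                ((setT `*` setT) `*` setT)); first by rewrite !setXTT.
transitivity ((law1 F mu b a k \x law2 F mu b a k) (setT `*` setT)
              * law3 F mu b a k setT).
  by apply: product_measure1E => //; exact: measurableX.
rewrite law3T mule1.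
transitivity (law1 F mu b a k setT * law2 F mu b a k setT).
  exact: product_measure1E.
by rewrite law1T probability_setT mule1.
Qed.

Lemma Q_setT : (forall x, 0 < tail F x)%R -> Q F mu b a setT = 1.
Proof.
move=> F0; rewrite -[RHS](prob_sum a) /Q/= /mseries.
apply: congr_lim; apply/funext => n; apply: eq_big_nat => k /andP[k0 _].
rewrite -[RHS]mule1; congr *%E; exact: run_law_setT.
Qed.

End total_mass.

(* Main.v *)
Require Import Defs.
From HB Require Import structures.
From mathcomp Require Import all_boot all_order all_algebra.
From mathcomp Require Import all_classical all_reals all_analysis.
From mathcomp Require Import measurable_realfun ring lra.
Import Order.TTheory GRing.Theory Num.Theory.
Import numFieldNormedType.Exports.
Local Open Scope classical_set_scope.
Local Open Scope ring_scope.

(** Nonnegativity of the three summands and [2 x y <= x^2 + y^2] give, on every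
    run, [Z^2 + nu >= sqrt nu * Z >= sqrt nu * Z1 / p]. Integrating over the run,
    finiteness of both [E Z^2] and [E nu] would therefore force
    [sum_k sqrt n_k * E Z1_k] to be finite; here [sqrt n_k >= sqrt i] for every
    [i] in the [k]-th window.

    The first estimator is a change of measure: making [X_j] exceed its level has
    density [1(X_j >= level j) / F[level j, oo)], and summing over [j] cancels the
    count in the denominator of [Z1]. Hence [E Z1_k] is at least a constant times
    the probability that the walk crosses its boundary within the window, a jump
    above its level also occurring there ([integral_law1_Z1_ge]).

    That probability is bounded below by disjoint single-jump scenarios: the walk
    stays under the line of slope [mu] for [i - 1] steps, does not fall below
    [- C i], and the [i]-th step exceeds [b + i (C + mu)], whence [tau = i]
    ([jumps_tau], [hits_probability_ge]). The first two requirements hold with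
    probability at least some [delta > 0] not depending on [i]
    ([stays_probability_ge]). Staying under the line has positive probability by
    Garsia's proof of the maximal ergodic lemma, applied to steps truncated from
    below ([drift_max_gt0_le]), and the bound [- C i] costs little by Markov's
    inequality. So the sum above dominates a multiple of
    [sum_i sqrt i * P(X > b + i (C + mu))].

    For a tail index below [3/2], doubling the argument eventually divides the
    tail by less than [2 sqrt 2], so each dyadic block of the last sum stays
    bounded away from zero and the sum diverges
    ([regular_variation_doubling], [sqrt_weighted_sum_unbounded]).

    Functionals of a path are functions on [seq R], measurable on tuples. Integrals over the product laws are then computed by splitting off the
    first or the last coordinate ([integral_indep_law_cons],
    [integral_indep_law_rcons]). *)

Set Implicit Arguments.
Unset Strict Implicit.
Unset Printing Implicit Defensive.

(** * Complements on integrals *)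

Section integral_complements.
Context d (T : measurableType d) (R : realType).
Local Open Scope ereal_scope.
Implicit Types (nu : {measure set T -> \bar R}) (f g : T -> \bar R).

(** The integral of a nonnegative function is a supremum over simple functions
    below it, so monotonicity does not need measurability. *)
Lemma ge0_le_integralT nu f g : (forall x, 0 <= f x) ->
  (forall x, f x <= g x) -> \int[nu]_x f x <= \int[nu]_x g x.
Proof.
move=> f0 fg; have g0 x : 0 <= g x by exact: le_trans (fg x).
rewrite !ge0_integralTE//; apply: le_ereal_sup => _ [h hf <-].
by exists h => // x; exact: le_trans (fg x).
Qed.

Lemma integral_cond_law (F : probability R R) (A : set R) (mA : measurable A)
    (h : R -> \bar R) : F A != 0 -> measurable_fun setT h ->
  (forall x, 0 <= h x) ->
  \int[cond_law F mA]_x h x = (fine (F A))^-1%:E * \int[F]_(x in A) h x.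
Proof.
move=> FA0 mh h0.
have r0 : (0 <= (fine (F A))^-1)%R by rewrite invr_ge0 fine_ge0.
rewrite (eq_measure_integral (mscale (NngNum r0) (mrestr F mA))); last first.
  by move=> B mB _; apply: etrans (cond_lawE _ _ FA0) _; rewrite muleC.
rewrite ge0_integral_mscale//=; congr (_ * _).
have mAC : measurable (~` A) by exact: measurableC.
rewrite -(setUv A) ge0_integral_setU//=; last 2 first.
- exact: measurable_funTS.
- by apply/disj_setPCl.
rewrite [X in _ + X](_ : _ = 0) ?adde0; last first.
  apply: null_set_integral => //; first exact: measurable_funTS.
  by rewrite /= /mrestr setICl measure0.
by apply: eq_measure_integral => B mB BA; rewrite /= /mrestr setIidl.
Qed.

Lemma measurable_EFin_bool (p : T -> bool) : measurable_fun setT p ->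
  measurable_fun setT (fun x => (p x)%:R%:E : \bar R).
Proof.
move=> mp; apply/measurable_EFinP.
exact: (@measurableT_comp _ _ _ _ _ _ (fun e : bool => e%:R : R)).
Qed.

Lemma integral_cst_probability (P : probability T R) (c : \bar R) :
  \int[P]_x c = c.
Proof. by rewrite integral_cst// [X in _ * X]probability_setT mule1. Qed.

Lemma ge0_integral_cstD (P : probability T R) (c : \bar R) f : 0 <= c ->
  measurable_fun setT f -> (forall x, 0 <= f x) ->
  \int[P]_x (c + f x) = c + \int[P]_x f x.
Proof.
by move=> c0 mf f0; rewrite ge0_integralD// integral_cst_probability.
Qed.

End integral_complements.

(** * Integration against the law of independent coordinates *)

Section indep_law_integral.
Context (R : realType).
Local Open Scope ereal_scope.
Implicit Types (F : probability R R) (m : nat -> probability R R)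
  (f : seq R -> \bar R).

Lemma measurable_rcons n :
  measurable_fun setT (fun yz : n.-tuple R * R => [tuple of rcons yz.1 yz.2]).
Proof.
apply/measurable_fun_tnthP => i.
have [lti|] := ltnP i n.
  rewrite (_ : _ \o _ = (fun x => tnth x (Ordinal lti)) \o fst); last first.
    apply/funext => -[y z] /=.
    rewrite !(tnth_nth (0%R : R))/= nth_rcons size_tuple.
    by rewrite lti.
  exact: measurableT_comp (measurable_tnth _) measurable_fst.
rewrite leq_eqVlt => /orP[/eqP ni|]; last by rewrite ltnNge -ltnS ltn_ord.
rewrite (_ : _ \o _ = snd)//.
apply/funext => -[y z] /=.
by rewrite (tnth_nth (0%R : R))/= nth_rcons size_tuple -ni ltnn eqxx.
Qed.

Lemma measurable_along_cons n d' (T : measurableType d') (f : seq R -> T) :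
  measurable_fun setT (fun x : n.+1.-tuple R => f x) ->
  measurable_fun setT (fun xy : R * n.-tuple R => f (xy.1 :: xy.2)).
Proof. by move=> mf; exact: (measurableT_comp mf (@measurable_cons_pair R n)). Qed.

Lemma measurable_along_rcons n d' (T : measurableType d') (f : seq R -> T) :
  measurable_fun setT (fun x : n.+1.-tuple R => f x) ->
  measurable_fun setT (fun yz : n.-tuple R * R => f (rcons yz.1 yz.2)).
Proof. by move=> mf; exact: (measurableT_comp mf (@measurable_rcons n)). Qed.

Lemma integral_indep_law_cons n m f :
  measurable_fun setT (fun x : n.+1.-tuple R => f x) -> (forall s, 0 <= f s) ->
  \int[indep_law n.+1 m]_x f x =
  \int[m 0%N]_x \int[indep_law n (m \o S)]_y f (x :: y).
Proof.
move=> mf f0.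
transitivity (\int[m 0%N \x indep_law n (m \o S)]_xy f (xy.1 :: xy.2)).
  apply: (ge0_integral_pushforward (@measurable_cons_pair R n) _ measurableT mf).
  by move=> y _; exact: f0.
apply: (fubini_tonelli1 (fun xy : R * n.-tuple R => f (xy.1 :: xy.2))) => //.
exact: measurable_along_cons.
Qed.

Lemma integral_indep_law0 m f :
  \int[indep_law 0 m]_x f x = f [::].
Proof.
rewrite integral_dirac//=; first by rewrite diracT mul1e.
move=> _ B mB; rewrite setTI.
have [B0|B0] := pselect (B (f [::])).
  rewrite [X in measurable X](_ : _ = setT)//.
  by apply/seteqP; split => // x _ /=; rewrite (tuple0 x).
rewrite [X in measurable X](_ : _ = set0)//.
by apply/seteqP; split => // x /=; rewrite (tuple0 x).
Qed.

Lemma integral_indep_law_rcons n F f :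
  measurable_fun setT (fun x : n.+1.-tuple R => f x) -> (forall s, 0 <= f s) ->
  \int[indep_law n.+1 (fun=> F)]_x f x =
  \int[indep_law n (fun=> F)]_y \int[F]_z f (rcons y z).
Proof.
elim: n f => [|n IHn] f mf f0.
  rewrite integral_indep_law_cons//.
  rewrite (integral_indep_law0 _ (fun y : seq R => \int[F]_z f (rcons y z))).
  by apply: eq_integral => x _; rewrite (integral_indep_law0 _ (fun y : seq R => f (x :: y))).
rewrite integral_indep_law_cons//.
pose g y := \int[F]_z f (rcons y z).
have mg : measurable_fun setT (fun y : n.+1.-tuple R => g y).
  apply: (measurable_fun_fubini_tonelli_F
    (fun yz : n.+1.-tuple R * R => f (rcons yz.1 yz.2))) => //.
  exact: measurable_along_rcons.
have g0 y : 0 <= g y by apply: integral_ge0.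
rewrite (integral_indep_law_cons _ mg g0).
apply: eq_integral => x _.
rewrite (IHn (fun y : seq R => f (x :: y)))//.
exact: (measurableT_comp (measurable_along_cons mf) (measurable_pair1 x)).
Qed.

End indep_law_integral.

Section coordinates.
Context (R : realType).
Local Open Scope ereal_scope.
Implicit Types (F : probability R R) (m : nat -> probability R R)
  (f : seq R -> \bar R).

Lemma measurable_integral_cons n m f :
  measurable_fun setT (fun x : n.+1.-tuple R => f x) -> (forall s, 0 <= f s) ->
  measurable_fun setT (fun x => \int[indep_law n m]_y f (x :: y)).
Proof.
move=> mf f0; apply: (measurable_fun_fubini_tonelli_F
    (fun xy : R * n.-tuple R => f (xy.1 :: xy.2))) => //.
exact: measurable_along_cons.
Qed.

Lemma measurable_indic_increment n j (A : set R) : measurable A ->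
  measurable_fun setT
    (fun x : n.-tuple R => (\1_A (increment x j) : R)%:E).
Proof.
move=> mA; apply/measurable_EFinP.
apply: (measurableT_comp (measurable_indic mA)).
exact: measurable_increment.
Qed.

(** Conditioning the coordinate of index [j] (counted from 0) on being in [A]
    gives the density [\1_A / F A] with respect to the unconditioned law. *)
Lemma integral_indep_law_cond F (A : set R) (mA : measurable A) n j f :
    F A != 0 -> (j < n)%N ->
    measurable_fun setT (fun x : n.-tuple R => f x) -> (forall s, 0 <= f s) ->
  \int[indep_law n (fun i => if i == j then cond_law F mA else F)]_x f x =
  (fine (F A))^-1%:E *
  \int[indep_law n (fun=> F)]_x (f x * (\1_A (increment x j.+1))%:E).
Proof.
move=> FA0; have r0 : (0 <= (fine (F A))^-1)%R by rewrite invr_ge0 fine_ge0.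
elim: n j f => [//|n IHn] j f jn mf f0.
have mf' i : measurable_fun setT (fun x : n.+1.-tuple R =>
    f x * (\1_A (increment x i))%:E).
  apply: emeasurable_funM => //; exact: measurable_indic_increment.
have f0' i s : 0 <= f s * (\1_A (increment s i))%:E by rewrite mule_ge0// lee_fin.
rewrite integral_indep_law_cons//.
rewrite (@integral_indep_law_cons _ _ _
  (fun x => f x * (\1_A (increment x j.+1))%:E))//.
have [j0|j0] := posnP j.
  rewrite j0 integral_cond_law//; last 2 first.
  - exact: measurable_integral_cons.
  - by move=> x; apply: integral_ge0.
  congr (_ * _); rewrite integral_mkcond; apply: eq_integral => x _.
  rewrite patchE/= /increment/= indicE; case: (x \in A).
    by apply: eq_integral => y _; rewrite mule1.
  by rewrite integral0_eq// => y _; rewrite mule0.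
case: j j0 jn mf' f0' => // j _ jn mf' f0'.
rewrite -ge0_integralZl//; last 2 first.
- exact: (@measurable_integral_cons _ _
    (fun x => f x * (\1_A (increment x j.+2))%:E)).
- by move=> x _; apply: integral_ge0.
apply: eq_integral => x _; rewrite -(IHn j (fun y : seq R => f (x :: y)))//.
exact: (measurableT_comp (measurable_along_cons mf) (measurable_pair1 x)).
Qed.

(** A function that ignores all entries after the first [n] only sees the law of
    the first [n] coordinates. *)
Lemma integral_indep_law_drop F n k f :
    (forall s z, (n <= size s)%N -> f (rcons s z) = f s) ->
    (forall i, measurable_fun setT (fun x : i.-tuple R => f x)) ->
    (forall s, 0 <= f s) ->
  \int[indep_law (k + n) (fun=> F)]_x f x = \int[indep_law n (fun=> F)]_x f x.
Proof.
move=> fn mf f0; elim: k => [//|k IHk].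
rewrite addSn integral_indep_law_rcons// -IHk; apply: eq_integral => y _.
rewrite (eq_integral (cst (f y))); last first.
  by move=> z _; rewrite fn// size_tuple leq_addl.
by rewrite integral_cst_probability.
Qed.

End coordinates.

(** * The maximum of the random walk *)

Section path_functionals.
Context (R : realType).
Implicit Types (s : seq R) (mu : R).

Lemma walkE s n : walk s n = \sum_(0 <= i < n) nth 0 s i.
Proof. by rewrite /walk big_add1. Qed.

Lemma walk_cons x s n : walk (x :: s) n.+1 = x + walk s n.
Proof. by rewrite !walkE big_nat_recl. Qed.

Lemma walk0 s : walk s 0 = 0.
Proof. by rewrite walkE big_nil. Qed.

Lemma walkS s n : walk s n.+1 = walk s n + increment s n.+1.
Proof. by rewrite !walkE big_nat_recr. Qed.

Lemma increment_rcons s z i : (0 < i <= size s)%N ->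
  increment (rcons s z) i = increment s i.
Proof.
by case: i => //= i; rewrite /increment/= nth_rcons => ->.
Qed.

Lemma walk_rcons s z n : (n <= size s)%N -> walk (rcons s z) n = walk s n.
Proof.
move=> ns; apply: eq_big_nat => i /andP[i0 ilen].
by rewrite increment_rcons// i0 (leq_trans _ ns).
Qed.

(** The maximum of [walk s n - n mu] over [0 <= n <= size s], by recursion on the
    first step; that it is an upper bound is [walk_le_drift_max]. *)
Fixpoint drift_max mu s : R :=
  if s is x :: s' then Num.max 0 (x - mu + drift_max mu s') else 0.

Lemma drift_max_ge0 mu s : 0 <= drift_max mu s.
Proof. by case: s => //= x s; rewrite le_max lexx. Qed.

Lemma walk_le_drift_max mu s n : (n <= size s)%N ->
  walk s n - n%:R * mu <= drift_max mu s.
Proof.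
elim: s n => [|x s IHs] [|n] //=; rewrite ?walk0 ?mul0r ?subrr//.
  by rewrite le_max lexx.
move=> ns; rewrite le_max walk_cons; apply/orP; right.
have := IHs n ns; rewrite -natr1; lra.
Qed.

Lemma drift_max_rcons mu s z : drift_max mu s <= drift_max mu (rcons s z).
Proof.
elim: s => [|x s IHs] /=; first by rewrite le_max lexx.
by rewrite ge_max !le_max lexx/= lerD2l IHs orbT.
Qed.

(** The sum of the absolute values of the steps. *)
Definition abs_sum s : R := \sum_(x <- s) `|x|.

Lemma abs_walk_le_abs_sum s n : `|walk s n| <= abs_sum s.
Proof.
rewrite /abs_sum; elim: s n => [|x s IHs] n.
  rewrite big_nil walkE big1 ?normr0// => i _; exact: nth_nil.
case: n => [|n]; first by rewrite walk0 normr0 sumr_ge0.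
rewrite walk_cons big_cons (le_trans (ler_normD _ _))// lerD2l.
exact: IHs.
Qed.

Lemma measurable_drift_max mu n :
  measurable_fun setT (fun x : n.-tuple R => drift_max mu x).
Proof.
elim: n => [|n IHn].
  rewrite (_ : (fun x => _) = cst 0)//.
  by apply/funext => x; rewrite (tuple0 x).
rewrite (_ : (fun x => _) = fun x : n.+1.-tuple R => Num.max 0
  (tnth x ord0 - mu + drift_max mu [tuple of behead x])); last first.
  by apply/funext => x; case/tupleP: x => y x /=; rewrite tnth0.
apply: measurable_maxr => //; apply: measurable_funD.
  by apply: measurable_funB => //; exact: measurable_tnth.
exact: (measurableT_comp IHn (@measurable_behead _ _ _)).
Qed.

Lemma measurable_abs_sum n :
  measurable_fun setT (fun x : n.-tuple R => abs_sum x).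
Proof.
rewrite (_ : (fun x => _) = fun x : n.-tuple R => \sum_(i < n) `|tnth x i|).
  apply: measurable_sum => i; apply: measurableT_comp => //.
  exact: measurable_tnth.
by apply/funext => x; rewrite /abs_sum big_tuple.
Qed.

End path_functionals.

(** * Staying below the drift line *)

Section staying_below.
Context (R : realType) (F : probability R R).
Local Open Scope ereal_scope.
Local Notation E n := (indep_law n (fun=> F)).

Lemma integral_abs_sum n :
  \int[E n]_s (abs_sum s)%:E = n%:R%:E * \int[F]_x `|x|%:E.
Proof.
elim: n => [|n IHn].
  rewrite (integral_indep_law0 _ (fun s : seq R => (abs_sum s)%:E)).
  by rewrite /abs_sum big_nil mul0e.
rewrite (@integral_indep_law_cons _ n _ (fun s => (abs_sum s)%:E)); last 2 first.
- by apply/measurable_EFinP; exact: measurable_abs_sum.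
- by move=> s; rewrite lee_fin sumr_ge0.
rewrite -(@natr1 _ n) EFinD ge0_muleDl// mul1e -IHn.
have mA k : measurable_fun setT (fun s : k.-tuple R => (abs_sum s)%:E).
  by apply/measurable_EFinP; exact: measurable_abs_sum.
have A0 s : 0 <= (abs_sum s)%:E :> \bar R by rewrite lee_fin sumr_ge0.
rewrite -ge0_integral_cstD//; last 2 first.
- exact: integral_ge0.
- by apply/measurable_EFinP; exact: normr_measurable.
apply: eq_integral => x _; rewrite addeC -ge0_integral_cstD//; last exact: mA.
by apply: eq_integral => s _; rewrite -EFinD /abs_sum big_cons.
Qed.

(** Garsia's argument for the maximal ergodic lemma, applied to the steps
    [x - mu] truncated from below at [- c] and then shifted by [c]. *)
Lemma drift_max_gt0_le (mu c : R) n : \int[F]_x `|x|%:E < +oo -> (0 < c)%R ->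
  c%:E * \int[E n.+1]_s (0 < drift_max mu s)%R%:R%:E <=
  \int[F]_x (Num.max 0 (x - mu + c))%:E.
Proof.
move=> F_int c0; set I := \int[F]_x _.
have pos_ge0 x : 0 <= (Num.max 0 (x - mu + c))%:E.
  by rewrite lee_fin le_max lexx.
have mpos : measurable_fun setT (fun x : R => (Num.max 0 (x - mu + c))%:E).
  apply/measurable_EFinP; apply: measurable_maxr => //.
  by apply: measurable_funD => //; exact: measurable_funB.
have M0 s : 0 <= (drift_max mu s)%:E by rewrite lee_fin drift_max_ge0.
have mM k : measurable_fun setT (fun s : k.-tuple R => (drift_max mu s)%:E).
  by apply/measurable_EFinP; exact: measurable_drift_max.
have m1 k : measurable_fun setT
    (fun s : k.-tuple R => (0 < drift_max mu s)%R%:R%:E : \bar R).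
  apply: measurable_EFin_bool.
  by apply: measurable_fun_ltr => //; exact: measurable_drift_max.
have i0 s : 0 <= (0 < drift_max mu s)%R%:R%:E :> \bar R by rewrite lee_fin.
pose J (s : seq R) : \bar R := c%:E * (0 < drift_max mu s)%R%:R%:E.
have J0 s : 0 <= J s by rewrite mule_ge0// lee_fin ltW.
have mJ k : measurable_fun setT (fun s : k.-tuple R => J s).
  by apply: emeasurable_funM; [exact: measurable_cst|exact: m1].
pose D n := \int[E n]_s (drift_max mu s)%:E.
have D0 k : 0 <= D k by apply: integral_ge0.
(* Removing the first step decreases the maximum by at most that step, and by
   exactly that step where the maximum is positive. *)
have step k : D k.+1 + c%:E * \int[E k.+1]_s (0 < drift_max mu s)%R%:R%:E <=
    D k + I.
  have -> : c%:E * \int[E k.+1]_s (0 < drift_max mu s)%R%:R%:E =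
      \int[E k.+1]_s J s.
    by rewrite [RHS]ge0_integralZl//; [exact: m1|rewrite lee_fin ltW].
  have -> : D k.+1 + \int[E k.+1]_s J s =
      \int[E k.+1]_s ((drift_max mu s)%:E + J s).
    by rewrite [RHS]ge0_integralD//; [exact: mM|exact: mJ].
  rewrite (@integral_indep_law_cons _ k _ (fun s => (drift_max mu s)%:E + J s)); last 2 first.
  - by apply: emeasurable_funD; [exact: mM|exact: mJ].
  - by move=> s; rewrite adde_ge0.
  have -> : D k + I = \int[F]_x (D k + (Num.max 0 (x - mu + c))%:E).
    by rewrite ge0_integral_cstD//; exact: D0.
  apply: ge0_le_integralT => [x|x].
    by apply: integral_ge0 => s _; rewrite adde_ge0.
  have -> : D k + (Num.max 0 (x - mu + c))%:E =
      \int[E k]_s ((Num.max 0 (x - mu + c))%:E + (drift_max mu s)%:E).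
    rewrite addeC; apply/esym; apply: ge0_integral_cstD => //; exact: mM.
  apply: ge0_le_integralT => [s|s].
    by rewrite adde_ge0.
  rewrite /J -EFinM -!EFinD lee_fin [drift_max _ (_ :: _)]/=.
  have := drift_max_ge0 mu s; move: (drift_max mu s) => M M_ge0.
  have [h|h] := leP (x - mu + M)%R 0%R; rewrite ?ltxx ?h/= ?mulr0 ?mulr1.
    by rewrite addr0 addr_ge0// le_max lexx.
  have [?|?] := leP (x - mu + c)%R 0%R; lra.
(* Adding a last step cannot decrease the maximum. *)
have mono k : D k <= D k.+1.
  rewrite /D (@integral_indep_law_rcons _ k _ (fun s => (drift_max mu s)%:E))//.
  apply: ge0_le_integralT => // y.
  have -> : (drift_max mu y)%:E = \int[F]_z (drift_max mu y)%:E.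
    by rewrite integral_cst_probability.
  by apply: ge0_le_integralT => // z; rewrite lee_fin drift_max_rcons.
have Ifin : I < +oo.
  apply: (@le_lt_trans _ _ (\int[F]_x ((`|mu| + c)%:E + `|x|%:E))).
    apply: ge0_le_integralT => // x; rewrite -EFinD lee_fin ge_max.
    have := normr_ge0 x; have := normr_ge0 mu; have := ler_norm x.
    have := ler_norm (- mu)%R; rewrite normrN => ? ? ? ?.
    by apply/andP; split; lra.
  rewrite ge0_integral_cstD//; last 2 first.
  - by rewrite lee_fin addr_ge0// ltW.
  - by apply/measurable_EFinP; exact: normr_measurable.
  by apply: lte_add_pinfty => //; rewrite ltry.
have Dfin k : D k < +oo.
  elim: k => [|k IHk].
    rewrite /D (integral_indep_law0 _ (fun s : seq R => (drift_max mu s)%:E)).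
    by rewrite ltry.
  apply: le_lt_trans (lte_add_pinfty IHk Ifin).
  apply: le_trans (step k); rewrite leeDl//; apply: mule_ge0.
    by rewrite lee_fin ltW.
  by apply: integral_ge0.
rewrite -(@leeD2lE _ (D n.+1)) ?ge0_fin_numE//.
by apply: le_trans (step n) _; exact: leeD2r.
Qed.

End staying_below.

Section positive_probability.
Context (R : realType) (F : probability R R) (mu : R).
Local Open Scope ereal_scope.
Hypotheses (mu0 : (0 < mu)%R) (F_int : F.-integrable setT EFin)
  (F_mean : \int[F]_x x%:E = 0).
Local Notation E n := (indep_law n (fun=> F)).

(** Truncating the steps from below far enough keeps their mean negative: the
    steps [max (x - mu) (- c)] have mean at most [- mu / 2]. *)
Lemma exists_truncation : exists2 c : R, (0 < c)%R &
  \int[F]_x (Num.max 0 (x - mu + c))%:E <= (c - mu / 2)%:E.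
Proof.
have mugt0 := mu0.
have bnd (N x : R) : (0 <= N -> `|Num.max (- N) (x - mu)| <= `|x| + mu)%R.
  move=> N0; have := ler_norm x; have := ler_norm (- x)%R; rewrite normrN => ? ?.
  by rewrite ler_norml; have [?|?] := leP (- N)%R (x - mu)%R;
    apply/andP; split; lra.
have trunc (N x : R) : Num.max 0%R (x - mu + N)%R = (N + Num.max (- N) (x - mu))%R.
  by have [?|?] := leP (- N)%R (x - mu)%R;
    have [?|?] := leP 0%R (x - mu + N)%R; lra.
pose f_ (n : nat) (x : R) : \bar R := (Num.max (- n%:R) (x - mu))%:E.
have mf_ n : measurable_fun setT (f_ n).
  apply/measurable_EFinP; apply: measurable_maxr => //.
  exact: measurable_funB.
have mf : measurable_fun setT (fun x : R => (x - mu)%:E).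
  by apply/measurable_EFinP; exact: measurable_funB.
have mu_int : F.-integrable setT (cst mu%:E).
  exact: finite_measure_integrable_cst.
have ig : F.-integrable setT (fun x => `|x|%:E + mu%:E).
  by apply: (@integrableD _ _ _ F _ measurableT (abse \o EFin) (cst mu%:E)) => //;
     exact: integrable_abse.
have [] := @dominated_convergence _ _ _ F setT measurableT f_
  (fun x => (x - mu)%:E) (fun x => `|x|%:E + mu%:E) mf_ mf _ ig.
- apply: aeW => x _; apply: cvg_near_cst.
  near=> n; rewrite /f_ (elimT max_idPr)// lerNl.
  rewrite (le_trans (ler_norm _))//; near: n; exact: nbhs_infty_ger.
- apply: aeW => x n _; rewrite /f_ -EFinD lee_fin.
  exact: bnd.
move=> _ _ cvgI.
have limE : \int[F]_x (x - mu)%:E = (- mu)%:E.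
  rewrite (_ : (fun x => _) = (fun x : R => x%:E - (cst mu%:E) x)); last first.
    by apply/funext => x; rewrite EFinB.
  by rewrite integralB_EFin// F_mean integral_cst_probability sub0e.
rewrite limE in cvgI.
have /cvgI [N _ IN] : nbhs (- mu)%:E [set y : \bar R | y < (- (mu / 2))%:E].
  by apply: open_ereal_lt'; rewrite lte_fin ltrN2; lra.
have := IN N.+1 (leqnSn N) => /= IN1.
exists N.+1%:R => //.
rewrite (_ : \int[F]_x _ = N.+1%:R%:E + \int[F]_x f_ N.+1 x).
  by rewrite EFinB leeD2l// -EFinN ltW.
have -> : N.+1%:R%:E + \int[F]_x f_ N.+1 x = \int[F]_x (cst N.+1%:R%:E x + f_ N.+1 x).
  rewrite integralD// ?integral_cst_probability//.
  - exact: finite_measure_integrable_cst.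
  - apply: le_integrable ig => // x _; rewrite /f_ -EFinD !abse_EFin lee_fin.
    rewrite (ger0_norm (_ : 0 <= `|x| + mu)%R); first exact: bnd.
    by rewrite addr_ge0// ltW.
apply: eq_integral => x _; by rewrite trunc EFinD.
Unshelve. all: by end_near. Qed.

(** The positions at times [0] to [n] are on or below the line of slope [mu], and
    the last of them is above [- C (n + 1)]. *)
Definition stays (C : R) n (s : seq R) : bool :=
  all (fun m => walk s m - m%:R * mu <= 0)%R (iota 0 n.+1) &&
  (- (C * n.+1%:R) < walk s n)%R.

Lemma measurable_stays C n k :
  measurable_fun setT (fun x : k.-tuple R => stays C n x).
Proof.
apply: measurable_and; last first.
  by apply: measurable_fun_ltr => //; exact: measurable_walk.
elim: (iota _ _) => [|m s IHs]/=; first exact: measurable_cst.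
apply: measurable_and => //; apply: measurable_fun_ler => //.
by apply: measurable_funB => //; exact: measurable_walk.
Qed.

(** The probability of not exceeding the line is at least [mu / (2 c)] for the
    truncation level [c]; [C] is such that Markov's inequality for the lower bound
    costs at most half of it. *)
Lemma stays_probability_ge : exists C delta : R, [/\ (0 < C)%R, (0 < delta)%R &
  forall n, delta%:E <= \int[E n]_s (stays C n s)%:R%:E].
Proof.
have mugt0 := mu0.
have [c c0 cE] := exists_truncation.
have absfin : \int[F]_x `|x|%:E < +oo by case/integrableP: F_int.
have abs0 : 0 <= \int[F]_x `|x|%:E by apply: integral_ge0.
have [m1 m1E] : exists m1, \int[F]_x `|x|%:E = m1%:E.
  by exists (fine (\int[F]_x `|x|%:E)); rewrite fineK// ge0_fin_numE.
have m10 : (0 <= m1)%R by rewrite -lee_fin -m1E.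
pose C : R := (4 * c * m1 / mu + 1)%R; exists C, (mu / (4 * c))%R.
have C0 : (0 < C)%R by rewrite /C ltr_wpDl// !mulr_ge0 ?invr_ge0// ltW.
split=> // [|n]; first by rewrite divr_gt0// mulr_gt0.
have mpos : measurable_fun setT (fun s : n.-tuple R =>
    (0 < drift_max mu s)%R%:R%:E : \bar R).
  apply: measurable_EFin_bool.
  by apply: measurable_fun_ltr => //; exact: measurable_drift_max.
have mst : measurable_fun setT (fun s : n.-tuple R =>
    (stays C n s)%:R%:E : \bar R).
  by apply: measurable_EFin_bool; exact: measurable_stays.
have mA : measurable_fun setT (fun s : n.-tuple R => (abs_sum s)%:E).
  by apply/measurable_EFinP; exact: measurable_abs_sum.
have A0 s : 0 <= (abs_sum s)%:E :> \bar R by rewrite lee_fin sumr_ge0.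
set p := \int[E n]_s _.
pose a := \int[E n]_s (0 < drift_max mu s)%R%:R%:E.
have bool_fin (q : seq R -> bool) : exists2 r : R, (0 <= r)%R &
    \int[E n]_s (q s)%:R%:E = r%:E.
  have q0 : 0 <= \int[E n]_s (q s)%:R%:E by apply: integral_ge0 => s _; rewrite lee_fin.
  have qfin : \int[E n]_s (q s)%:R%:E \is a fin_num.
    rewrite ge0_fin_numE//; apply: (@le_lt_trans _ _ (\int[E n]_s 1)).
      by apply: ge0_le_integralT => s; rewrite lee_fin//; case: (q s).
    by rewrite integral_cst_probability ltry.
  exists (fine (\int[E n]_s (q s)%:R%:E)); first exact: fine_ge0.
  by rewrite fineK.
have [rp rp0 pE] := bool_fin (stays C n).
have [ra ra0 aE] := bool_fin (fun s => 0 < drift_max mu s)%R.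
have ca : (c * ra <= c - mu / 2)%R.
  rewrite -lee_fin EFinM -aE; case: (n) => [|k]; last first.
    exact: le_trans (drift_max_gt0_le mu k absfin c0) cE.
  rewrite (integral_indep_law0 _ (fun s => (0 < drift_max mu s)%R%:R%:E)).
  rewrite /= ltxx mule0; apply: le_trans cE; apply: integral_ge0 => x _.
  by rewrite lee_fin le_max lexx.
pose k : R := (C * n.+1%:R)%R.
have k0 : (0 < k)%R by rewrite mulr_gt0.
(* On each path: the line is exceeded, or [stays] holds, or the sum of the
   absolute steps is at least [k]. *)
have main : (1%:E : \bar R) <= ra%:E + (rp%:E + k^-1%:E * (n%:R%:E * m1%:E)).
  rewrite -m1E -integral_abs_sum// -aE -pE.
  rewrite -ge0_integralZl//; last by rewrite lee_fin invr_ge0 ltW.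
  rewrite -ge0_integralD//; last 2 first.
  - by move=> s _; rewrite mule_ge0// lee_fin invr_ge0 ltW.
  - exact: measurable_funeM.
  rewrite -ge0_integralD//; last 2 first.
  - by move=> s _; rewrite adde_ge0 ?mule_ge0// lee_fin ?invr_ge0 ?ltW.
  - by apply: emeasurable_funD => //; exact: measurable_funeM.
  rewrite -[leLHS](integral_cst_probability (E n)).
  apply: ge0_le_integralT => // s; rewrite -EFinM -!EFinD lee_fin.
  have As0 : (0 <= k^-1 * abs_sum s)%R.
    by apply: mulr_ge0; [rewrite invr_ge0 ltW|exact: sumr_ge0].
  have [Mpos|M0] := ltP 0%R (drift_max mu s).
    by rewrite lerDl addr_ge0.
  rewrite add0r /stays; case: allP => [_|[]]; last first.
    move=> m; rewrite mem_iota/= add0n ltnS => mn.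
    by rewrite (le_trans _ M0)// walk_le_drift_max// size_tuple.
  have [_|low] := ltP (- (C * n.+1%:R))%R (walk s n); first by rewrite lerDl.
  rewrite add0r -/k -ler_pdivrMl ?invr_gt0// invrK mulr1.
  apply: le_trans (abs_walk_le_abs_sum s n); rewrite -normrN.
  by rewrite (le_trans _ (ler_norm _))// lerNr.
move: main; rewrite -!EFinM -!EFinD lee_fin /p pE lee_fin => main.
have kn : (k^-1 * (n%:R * m1) <= m1 / C)%R.
  rewrite /k invfM -mulrA [leRHS]mulrC ler_pM2l ?invr_gt0//.
  by rewrite ler_pdivrMl// ler_wpM2r// ler_nat.
have m1C : (m1 / C <= mu / (4 * c))%R.
  rewrite ler_pdivrMr// /C mulrDr mulr1.
  have -> : (mu / (4 * c) * (4 * c * m1 / mu) = m1)%R.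
    by field; rewrite !gt_eqF.
  by rewrite lerDl ltW// divr_gt0// mulr_gt0.
have ra_le : (ra <= 1 - 2 * (mu / (4 * c)))%R.
  rewrite -(ler_pM2l c0) (le_trans ca)// le_eqVlt; apply/orP; left; apply/eqP.
  by field; rewrite gt_eqF.
lra.
Qed.

End positive_probability.

(** * First passage by a single big jump *)

Section big_jump.
Context (R : realType) (F : probability R R) (mu b C : R).
Hypotheses (b_gt0 : 0 < b) (C_gt0 : 0 < C).
Local Notation E n := (indep_law n (fun=> F)).

(** After [n] steps of moderate size, step [n + 1] is so large that the walk
    passes its boundary, wherever it was after step [n]. *)
Definition jumps n (s : seq R) : bool :=
  stays mu C n s && (b + n.+1%:R * (C + mu) < increment s n.+1).

Lemma stays_rcons n s z : (n <= size s)%N ->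
  stays mu C n (rcons s z) = stays mu C n s.
Proof.
move=> ns; rewrite /stays walk_rcons//; congr (_ && _).
apply: eq_in_all => m; rewrite mem_iota add0n ltnS => /= mn.
by rewrite walk_rcons// (leq_trans mn).
Qed.

Lemma jumps_rcons n s z : (n < size s)%N ->
  jumps n (rcons s z) = jumps n s.
Proof.
by move=> ns; rewrite /jumps stays_rcons ?(ltnW ns)// increment_rcons.
Qed.

Lemma measurable_jumps n k :
  measurable_fun setT (fun x : k.-tuple R => jumps n x).
Proof.
apply: measurable_and; first exact: measurable_stays.
by apply: measurable_fun_ltr => //; exact: measurable_increment.
Qed.

Lemma jumps_tau n s : (n < size s)%N -> jumps n s -> tau mu b s = n.+1.
Proof.
rewrite /jumps /stays => ns /andP[/andP[/allP low above_low] big].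
pose p m := b < walk s m - m%:R * mu.
have pn : p n.+1.
  rewrite /p walkS; move: above_low big; set N : R := n.+1%:R => H1 H2.
  have -> : walk s n + increment s n.+1 - N * mu =
      b + (walk s n + C * N) + (increment s n.+1 - (b + N * (C + mu))) by ring.
  by rewrite -addrA ltrDl addr_gt0// ?subr_gt0// -ltrBlDr sub0r.
have pm m : (m < n.+1)%N -> p m = false.
  move=> mn; apply/negbTE; rewrite -leNgt.
  by rewrite (le_trans (low m _)) ?ltW// mem_iota.
have hasp : has p (iota 0 (size s).+1).
  by apply/hasP; exists n.+1 => //; rewrite mem_iota.
apply/eqP; rewrite eqn_leq; apply/andP; split; rewrite leqNgt; apply/negP => lt.
  have := before_find 0%N lt; rewrite nth_iota ?add0n; last exact: ns.
  by rewrite -/(p _) pn.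
have := nth_find 0%N hasp; rewrite nth_iota ?add0n; last first.
  by rewrite (leq_trans lt)// ltnW.
by rewrite pm.
Qed.

Lemma jumps_level n s : jumps n s -> level mu b n.+1 < increment s n.+1.
Proof.
rewrite /jumps => /andP[_]; apply: le_lt_trans; rewrite /level lerD2l ler_wpM2l//.
by rewrite lerDr ltW.
Qed.

(** The events [jumps] are disjoint for different indices, as they fix the value
    of [tau]. *)
Lemma sum_jumps_le (s : seq R) (lo hi : nat) : (hi <= size s)%N ->
  \sum_(lo.+1 <= i < hi.+1) (jumps i.-1 s)%:R <=
  ((lo < tau mu b s <= hi)%N &&
   has (fun i => level mu b i < increment s i) (index_iota lo.+1 hi.+1))%:R :> R.
Proof.
move=> his; set h := _ && _.
apply: (@le_trans _ _ (\sum_(lo.+1 <= i < hi.+1) (i == tau mu b s)%:R * h%:R)).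
  rewrite big_nat_cond [leRHS]big_nat_cond; apply: ler_sum => i /andP[/andP[loi ihi] _].
  have [j|_] := boolP (jumps i.-1 s); last by rewrite mulr_ge0.
  case: i loi ihi j => // n loi ihi j.
  have tn := jumps_tau (leq_trans (ihi : (n < hi)%N) his) j.
  rewrite tn eqxx mul1r /h tn; suff -> : has (fun i => level mu b i < increment s i)
      (index_iota lo.+1 hi.+1) by rewrite loi (ihi : (n < hi)%N).
  apply/hasP; exists n.+1; first by rewrite mem_index_iota loi.
  exact: jumps_level j.
rewrite -mulr_suml ler_piMl// -natr_sum.
rewrite (eq_bigr (fun i => if i == tau mu b s then 1 else 0)%N); last first.
  by move=> i _; case: eqP.
rewrite -big_mkcond sum1_count (eq_count (a2 := pred1 (tau mu b s)))//.
by rewrite count_uniq_mem ?iota_uniq// lern1 leq_b1.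
Qed.

Local Open Scope ereal_scope.

Lemma tailE (t : R) : (tail F t)%:E = F `]t, +oo[%classic.
Proof. by rewrite fineK// fin_num_measure. Qed.

Lemma jumps_probability n k :
  \int[E (k + n.+1)]_s (jumps n s)%:R%:E =
  (\int[E n]_s (stays mu C n s)%:R%:E) * (tail F (b + n.+1%:R * (C + mu)))%:E.
Proof.
rewrite (@integral_indep_law_drop _ F n.+1 k (fun s => (jumps n s)%:R%:E)); first last.
- by move=> s; rewrite lee_fin.
- by move=> i; apply: measurable_EFin_bool; exact: measurable_jumps.
- by move=> s z ns; rewrite jumps_rcons.
rewrite (@integral_indep_law_rcons _ n F (fun s => (jumps n s)%:R%:E)); last 2 first.
- by apply: measurable_EFin_bool; exact: measurable_jumps.
- by move=> s; rewrite lee_fin.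
rewrite muleC -ge0_integralZl//; last 2 first.
- by apply: measurable_EFin_bool; exact: measurable_stays.
- by rewrite lee_fin tail_ge0.
apply: eq_integral => y _; set t := (b + _)%R.
have incE z : increment (rcons y z) n.+1 = z.
  by rewrite /increment/= nth_rcons size_tuple ltnn eqxx.
under eq_integral => z _.
  rewrite /jumps incE stays_rcons ?size_tuple// -mulnb natrM EFinM.
  over.
rewrite ge0_integralZl//; last first.
  by apply: measurable_EFin_bool; exact: measurable_fun_ltr.
rewrite muleC; congr (_ * _); rewrite tailE -[X in _ = F X]setIT -integral_indic//.
by apply: eq_integral => z _; rewrite indicE mem_setE in_itv/= andbT.
Qed.

Lemma hits_probability_ge (delta : R) lo hi :
    (forall n, delta%:E <= \int[E n]_s (stays mu C n s)%:R%:E) ->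
  (delta * \sum_(lo.+1 <= i < hi.+1) tail F (b + i%:R * (C + mu)))%:E <=
  \int[E hi]_s ((lo < tau mu b s <= hi)%N &&
   has (fun i => level mu b i < increment s i)%R (index_iota lo.+1 hi.+1))%:R%:E.
Proof.
move=> stays_ge.
have mj n k : measurable_fun setT (fun s : k.-tuple R => (jumps n s)%:R%:E : \bar R).
  by apply: measurable_EFin_bool; exact: measurable_jumps.
apply: (@le_trans _ _ (\int[E hi]_s \sum_(lo.+1 <= i < hi.+1) (jumps i.-1 s)%:R%:E)).
  rewrite ge0_integral_sum//; last by move=> i; exact: mj.
  rewrite mulr_sumr -sumEFin big_nat_cond [leRHS]big_nat_cond.
  apply: lee_sum => i /andP[/andP[loi ihi] _].
  case: i loi ihi => // n loi ihi.
  have := jumps_probability n (hi - n.+1); rewrite subnK// => ->.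
  rewrite EFinM.
  by rewrite lee_wpmul2r// lee_fin tail_ge0.
apply: ge0_le_integralT => s; first by apply: sume_ge0 => i _; rewrite lee_fin.
by rewrite sumEFin lee_fin sum_jumps_le// size_tuple.
Qed.

End big_jump.

(** * The first estimator *)

Lemma integral_mixture d (T : measurableType d) (R : realType) (s : seq nat)
    (w : nat -> {nonneg R}) (m : nat -> probability T R) (h : T -> \bar R) :
  measurable_fun setT h -> (forall x, 0 <= h x)%E ->
  (\int[mixture s w m]_x h x =
   \sum_(j <- s) (w j)%:num%:E * \int[m j]_x h x)%E.
Proof.
move=> mh h0.
rewrite (eq_measure_integral (msum (fun i =>
    mscale (w (nth 0%N s i)) (m (nth 0%N s i))) (size s))); last first.
  by move=> A mA _; rewrite /= /mixture (big_nth 0%N) big_mkord.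
rewrite ge0_integral_measure_sum// (big_nth 0%N) big_mkord.
by apply: eq_bigr => i _; rewrite ge0_integral_mscale.
Qed.

Section first_estimator.
Context (R : realType) (F : probability R R) (mu b : R) (a : assignment R).
Variable k : nat.
Hypotheses (k_gt0 : (0 < k)%N) (tail_gt0 : forall x, 0 < tail F x).
Local Notation lo := (idx a k.-1).
Local Notation hi := (idx a k).
Local Notation E n := (indep_law n (fun=> F)).

Lemma lo_lt_hi : (lo < hi)%N.
Proof. by apply: (idx_incr a); rewrite prednK. Qed.

Lemma lo_le_hi : (lo <= hi)%N.
Proof. by case: (k) => // n; rewrite ltnW// (idx_incr a). Qed.

Lemma q_gt0 : 0 < q F mu b a k.
Proof.
rewrite /q /window big_nat_recr/=; last exact: lo_lt_hi.
by rewrite ltr_wpDl// sumr_ge0// => i _; exact: tail_ge0.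
Qed.

Lemma above_neq0 (c : R) : F `[c, +oo[%classic != 0%E.
Proof.
have : (0 < F `[c, +oo[%classic)%E.
  apply: (@lt_le_trans _ _ (F `]c, +oo[%classic)).
    by rewrite -[ltRHS]fineK ?fin_num_measure// lte_fin; exact: tail_gt0.
  apply: le_measure; rewrite ?inE//.
  by apply: subset_itvr; rewrite bnd_simp.
by rewrite lt_neqAle eq_sym => /andP[].
Qed.

Lemma measurable_hits_in_A : measurable_fun setT
  (fun x : hi.-tuple R => hits_in_window mu b a k x && in_A mu b a k x).
Proof.
apply: measurable_and.
  rewrite (_ : (fun x => _) = fun x : hi.-tuple R =>
      (lo < tau mu b x)%N && ~~ (hi < tau mu b x)%N); last first.
    by apply/funext => x; rewrite /hits_in_window -leqNgt.
  apply: measurable_and; first exact: measurable_lt_tau lo_le_hi.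
  by apply: measurable_neg; exact: measurable_lt_tau.
rewrite /in_A; elim: (window a k) => [|i s IHs] /=; first exact: measurable_cst.
apply: measurable_or => //; apply: measurable_fun_ltr => //.
exact: measurable_increment.
Qed.

Lemma measurable_Z1 :
  measurable_fun setT (fun x : hi.-tuple R => Z1 F mu b a k x).
Proof.
apply: measurable_funM; last first.
  apply: (@measurableT_comp _ _ _ _ _ _ (fun e : bool => e%:R : R)) => //.
  exact: measurable_hits_in_A.
apply: measurable_funM => //.
apply: (@measurableT_comp _ _ _ _ _ _ (fun e : nat => e%:R^-1 : R)) => //.
elim: (window a k) => [|i s IHs] /=; first exact: measurable_cst.
apply: measurable_fun_addn => //.
apply: (@measurableT_comp _ _ _ _ _ _ nat_of_bool) => //.
by apply: measurable_fun_ler => //; exact: measurable_increment.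
Qed.

Lemma Z1_ge0 x : 0 <= Z1 F mu b a k x.
Proof. by rewrite /Z1 !mulr_ge0 ?invr_ge0 ?q_ge0. Qed.

(** The factor [c] accounts for possible atoms of [F] at the levels: the weights of
    [J] involve the open half-lines above the levels, the conditioning the closed
    ones. *)
Lemma integral_law1_Z1_ge (c : R) : 0 <= c ->
    (forall j, c * fine (F `[level mu b j, +oo[%classic) <= tail F (level mu b j)) ->
  (c%:E * \int[E hi]_x (hits_in_window mu b a k x && in_A mu b a k x)%:R%:E <=
   \int[law1 F mu b a k]_x (Z1 F mu b a k x)%:E)%E.
Proof.
move=> c0 ctail.
have q0 := q_gt0.
have mZ : measurable_fun setT (fun x : hi.-tuple R => (Z1 F mu b a k x)%:E).
  by apply/measurable_EFinP; exact: measurable_Z1.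
have Z0 x : (0 <= (Z1 F mu b a k x)%:E)%E by rewrite lee_fin Z1_ge0.
pose A j := `[level mu b j, +oo[%classic : set R.
have mA j : measurable (A j) by exact: measurable_itv.
pose G j x := ((Z1 F mu b a k x)%:E * (\1_(A j) (increment x j))%:E)%E.
have G0 j x : (0 <= G j x)%E by rewrite mule_ge0// lee_fin.
have mG j : measurable_fun setT (fun x : hi.-tuple R => G j x).
  by apply: emeasurable_funM => //; exact: measurable_indic_increment.
have cq0 : 0 <= c / q F mu b a k by rewrite divr_ge0// ltW.
apply: (@le_trans _ _ (\sum_(j <- window a k)
    (c / q F mu b a k)%:E * \int[E hi]_x G j x)%E); last first.
  rewrite integral_mixture// big_seq [leRHS]big_seq; apply: lee_sum => j.
  rewrite mem_index_iota => /andP[loj jhi].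
  case: j loj jhi => // j loj jhi.
  have condE := @integral_indep_law_cond _ F (A j.+1) (measurable_itv _) hi j
    (fun x => (Z1 F mu b a k x)%:E) (above_neq0 _) jhi mZ Z0.
  rewrite [X in (_ <= _ * X)%E](_ : _ =
      (fine (F (A j.+1)))^-1%:E * \int[E hi]_x G j.+1 x)%E; last exact: condE.
  rewrite muleA -EFinM; apply: lee_wpmul2r; first exact: integral_ge0.
  have FA0 : 0 < fine (F (A j.+1)).
    rewrite fine_gt0// lt_neqAle eq_sym above_neq0 measure_ge0/=.
    by rewrite ltey_eq fin_num_measure.
  rewrite lee_fin /= mulrAC ler_pM2r ?invr_gt0// ler_pdivlMr//.
  exact: ctail.
rewrite -ge0_sume_distrr//; last by move=> j _; exact: integral_ge0.
rewrite -ge0_integral_sum//.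
rewrite EFinM -muleA lee_wpmul2l//.
rewrite -ge0_integralZl//; last 3 first.
- exact: emeasurable_sum.
- by move=> x _; exact: sume_ge0.
- by rewrite lee_fin invr_ge0 ltW.
apply: ge0_le_integralT => x; first by rewrite lee_fin.
(* The indicators of the exceedances add up to the count in [Z1]. *)
have -> : (\sum_(j <- window a k) G j x =
    (Z1 F mu b a k x * (count (fun i => level mu b i <= increment x i)
      (window a k))%:R)%:E)%E.
  rewrite -sum1_count natr_sum mulr_sumr -sumEFin [RHS]big_mkcond/=.
  apply: eq_bigr => j _; rewrite /G -EFinM indicE mem_setE in_itv/= andbT.
  by case: ifP; rewrite ?mulr0.
rewrite -EFinM lee_fin /Z1; case: andP => [[_ inA]|_]; last by rewrite mulr0 mul0r mulr0.
have count0 : (0 < count (fun i => level mu b i <= increment x i)%R (window a k))%N.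
  by rewrite -has_count; move: inA; apply: sub_has => i /= /ltW.
by rewrite mulr1 divfK ?mulVf ?gt_eqF// ltr0n.
Qed.

End first_estimator.

(** * The law of a run *)

Section run.
Context (R : realType) (F : probability R R) (mu b : R) (a : assignment R).
Local Open Scope ereal_scope.

Lemma law3_setT k : (0 < k)%N -> law3 F mu b a k setT = 1.
Proof.
move=> k0; have hi0 : (0 < idx a k)%N by exact: leq_ltn_trans (lo_lt_hi a k0).
apply: (etrans (mixture_setT _ _ _)).
rewrite /= /upto big_const_nat subn1/= iter_addr addr0.
by rewrite -mulr_natr mulVf// pnatr_eq0 -lt0n.
Qed.

Lemma measurable_fst_fst k :
  measurable_fun setT (fun x : runs R (idx a k) => x.1.1).
Proof. exact: measurableT_comp measurable_fst measurable_fst. Qed.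

Lemma integral_run_law_fst k (h : (idx a k).-tuple R -> \bar R) :
    (0 < k)%N -> measurable_fun setT h -> (forall x, 0 <= h x) ->
  \int[run_law F mu b a k]_x h x.1.1 = \int[law1 F mu b a k]_x h x.
Proof.
move=> k0 mh h0.
have pushE := ge0_integral_pushforward (@measurable_fst_fst k)
  (run_law F mu b a k) measurableT mh (fun x _ => h0 x).
apply: etrans (esym pushE) _.
apply: eq_measure_integral; first exact: measurable_fst_fst.
move=> mphi A mA _; rewrite /= /pushforward.
transitivity ((law1 F mu b a k \x law2 F mu b a k \x law3 F mu b a k)
      ((A `*` setT) `*` setT)).
  by congr (_ _); apply/seteqP; split => -[[x1 x2] x3] //= [[]].
transitivity ((law1 F mu b a k \x law2 F mu b a k) (A `*` setT) *
      law3 F mu b a k setT).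
  by apply: product_measure1E => //; exact: measurableX.
rewrite law3_setT// mule1.
transitivity (law1 F mu b a k A * law2 F mu b a k setT).
  exact: product_measure1E.
by rewrite [X in _ * X]probability_setT mule1.
Qed.

Lemma measurable_outcome d (T : measurableType d) (f : outcome R (idx a) -> T) :
  (forall k, measurable_fun setT (fun x => f (@run_of R (idx a) k x))) ->
  measurable_fun setT f.
Proof.
move=> mf _ Y mY; rewrite setTI.
suff: outcome_measurable (f @^-1` Y) by [].
move=> k.
by have := mf k measurableT Y mY; rewrite setTI.
Qed.

Lemma integral_law_given k (f : outcome R (idx a) -> \bar R) :
    measurable_fun setT f -> (forall w, 0 <= f w) ->
  \int[law_given F mu b k]_w f w =
  \int[run_law F mu b a k]_x f (@run_of R (idx a) k x).
Proof.
move=> mf f0.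
exact: (ge0_integral_pushforward (@measurable_run_of R (idx a) k) _ measurableT mf).
Qed.

(** The index [k] is shifted by one: [Q] only uses the pieces from [1] on. *)
Lemma integral_Q_ge N (f : outcome R (idx a) -> \bar R) :
    measurable_fun setT f -> (forall w, 0 <= f w) ->
  \sum_(k < N) (prob a k.+1)%:num%:E * \int[law_given F mu b k.+1]_w f w <=
  \int[Q F mu b a]_w f w.
Proof.
move=> mf f0.
have p0 k : (0 <= (prob a k)%:num)%R by [].
pose m (k : nat) : {measure set (outcome R (idx a)) -> \bar R} :=
  mscale (NngNum (p0 k.+1)) (@law_given R F mu b a k.+1).
rewrite [leLHS](_ : _ = \int[msum m N]_w f w); last first.
  rewrite ge0_integral_measure_sum//; apply: eq_bigr => k _.
  by rewrite ge0_integral_mscale.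
apply: ge0_le_measure_integral => // A mA.
rewrite /Q/= /mseries /msum -(big_mkord xpredT (fun k => m k A)).
rewrite -[leLHS](big_add1 _ _ 0%N N.+1 xpredT (fun k => m k.-1 A)).
rewrite (_ : \sum_(1 <= _ < _) _ = \sum_(1 <= k < N.+1)
    mscale (NngNum (p0 k)) (@law_given R F mu b a k) A).
  by apply: nneseries_lim_ge => k _ _; exact: measure_ge0.
by apply: eq_big_nat => -[].
Qed.

End run.

(** * Regularly varying tails *)

Section regular_variation.
Context (R : realType).
Local Notation rho := (2 * Num.sqrt 2 : R).

Lemma rho_gt0 : 0 < rho.
Proof. by rewrite mulr_gt0// sqrtr_gt0. Qed.

(** [rho = 2 `^ (3/2)], so a tail of index below [3/2] eventually loses less
    than a factor [rho] when its argument is doubled. *)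
Lemma regular_variation_doubling (alpha : R) (L G : R -> R) :
    alpha < 3%:R / 2%:R -> slowly_varying L -> (forall x, 0 <= G x) ->
    (forall x, 0 < x -> G x = x `^ (- alpha) * L x) ->
  exists x0 : R, [/\ 0 < x0, forall x, x0 <= x -> 0 < G x &
    forall x, x0 <= x -> rho^-1 * G x <= G (2 * x)].
Proof.
move=> alpha_lt Lsv G0 GE.
have rhoE : rho = 2 `^ (3%:R / 2%:R).
  rewrite (_ : 3%:R / 2%:R = 1 + 2^-1); last by field.
  by rewrite powRD ?pnatr_eq0 ?implybT// powRr1// powR12_sqrt.
pose r := rho^-1 * 2 `^ alpha.
have r0 : 0 < r by rewrite mulr_gt0 ?invr_gt0 ?rho_gt0// powR_gt0.
have r1 : r < 1.
  rewrite /r mulrC ltr_pdivrMr ?rho_gt0// mul1r rhoE.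
  by rewrite /powR pnatr_eq0/= ltr_expR ltr_pM2r// ln_gt0// ltr1n.
have near_gt : \forall x \near +oo, r < L (2 * x) / L x.
  by apply: (cvgr_gt (1 : R)) => //; apply: Lsv.
have [M [Mreal HM]] := near_gt.
exists (Num.max M 0 + 1).
have big x : Num.max M 0 + 1 <= x -> 0 < x /\ r < L (2 * x) / L x.
  move=> Mx; have xM : Num.max M 0 < x by rewrite (lt_le_trans _ Mx)// ltrDl.
  by move: xM; rewrite gt_max => /andP[/HM].
have pos x : Num.max M 0 + 1 <= x -> 0 < G x.
  move=> /big[x0 quot]; rewrite lt_neqAle G0 andbT eq_sym GE//.
  apply: mulf_neq0; first by rewrite gt_eqF ?powR_gt0.
  by apply: contraTneq quot => ->; rewrite invr0 mulr0 ltNge negbK ltW.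
split=> //; first by rewrite ltr_pwDr// le_max lexx orbT.
move=> x xbig; have [x0 quot] := big x xbig.
have Gx := pos x xbig.
have xa : 0 < x `^ (- alpha) by exact: powR_gt0.
have Lx : 0 < L x by move: Gx; rewrite GE// pmulr_rgt0.
rewrite ltr_pdivlMr// in quot.
rewrite !GE ?mulr_gt0// powRM ?(ltW x0)//.
have -> : rho^-1 = 2 `^ (- alpha) * r.
  by rewrite /r mulrCA -powRD ?pnatr_eq0 ?implybT// addNr powRr0 mulr1.
rewrite -(mulrA _ r) -(mulrA _ _ (L (2 * x))) ler_pM2l ?powR_gt0// mulrCA ler_pM2l//.
exact: ltW.
Qed.

(** By the doubling property, [rho ^ m * G (2 ^ m * D)] is eventually nondecreasing
    in [m]; up to a constant factor it is a lower bound for the [m]-th dyadic block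
    of the sum. *)
Lemma sqrt_weighted_sum_unbounded (G : R -> R) (x0 b c : R) :
    0 < x0 -> 0 < b -> 0 < c -> (forall x, 0 <= G x) ->
    {homo G : x y / x <= y >-> y <= x} ->
    (forall x, x0 <= x -> 0 < G x) ->
    (forall x, x0 <= x -> rho^-1 * G x <= G (2 * x)) ->
  forall B : R, exists N : nat,
    B <= \sum_(1 <= i < N.+1) Num.sqrt i%:R * G (b + i%:R * c).
Proof.
move=> x00 b0 c0 G0 Gmono Gpos Gdbl B.
have rho0 := rho_gt0.
pose D := b + c; have D0 : 0 < D by rewrite addr_gt0.
have [m0 m0P] : exists m0, x0 <= 2 ^+ m0 * D.
  exists (Num.truncn (x0 / D)).+1.
  rewrite -ler_pdivrMr// (le_trans (ltW (truncnS_gt _)))//.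
  by rewrite -natrX ler_nat ltnW// ltn_expl.
pose H m := rho ^+ m * G (2 ^+ m * D).
have pow_ge m : (m0 <= m)%N -> x0 <= 2 ^+ m * D.
  move=> mm; apply: le_trans m0P _; rewrite ler_wpM2r ?(ltW D0)//.
  by rewrite ler_weXn2l// ler1n.
have Hmono r : H m0 <= H (m0 + r)%N.
  elim: r => [|r IHr]; first by rewrite addn0.
  apply: le_trans IHr _; rewrite addnS /H; set m := (m0 + r)%N.
  have := Gdbl _ (pow_ge m (leq_addr _ _)).
  rewrite mulrA -exprS mulrC ler_pdivrMr// => dbl.
  by rewrite exprSr -mulrA ler_pM2l ?exprn_gt0// [leRHS]mulrC.
pose eps := rho^-1 * H m0.
have eps0 : 0 < eps.
  by rewrite /eps /H !mulr_gt0 ?invr_gt0 ?exprn_gt0 ?Gpos.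
pose f i : R := Num.sqrt i%:R * G (b + i%:R * c).
have f0 i : 0 <= f i by rewrite mulr_ge0.
have block m : (m0 <= m)%N -> eps <= \sum_(2 ^ m <= i < 2 ^ m.+1) f i.
  move=> mm; apply: (@le_trans _ _ (\sum_(2 ^ m <= i < 2 ^ m.+1)
      Num.sqrt (2 ^+ m) * G (2 ^+ m.+1 * D))); last first.
    rewrite big_nat [leRHS]big_nat; apply: ler_sum => i /andP[mi im].
    apply: ler_pM => //.
      by rewrite ler_sqrt ?exprn_ge0// -natrX ler_nat.
    apply: Gmono; rewrite /D mulrDr lerD//.
      by rewrite ler_peMl ?(ltW b0)// exprn_ege1// ler1n.
    by rewrite ler_wpM2r ?(ltW c0)// -natrX ler_nat ltnW.
  rewrite big_const_nat iter_addr addr0 expnS mul2n -addnn addnK -(mulr_natl _ (2 ^ m)).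
  rewrite natrX mulrA.
  have sqrtX : Num.sqrt (2 ^+ m : R) = Num.sqrt 2 ^+ m.
    by elim: (m) => [|k IHk]; rewrite ?expr0 ?sqrtr1// !exprS sqrtrM// IHk.
  rewrite sqrtX -exprMn /eps -ler_pdivlMl ?invr_gt0// invrK.
  rewrite mulrA -exprS -/(H m.+1).
  by rewrite -(subnKC (leqW mm)) Hmono.
have many r : r%:R * eps <= \sum_(1 <= i < 2 ^ (m0 + r)) f i.
  elim: r => [|r IHr]; first by rewrite mul0r sumr_ge0.
  rewrite (big_cat_nat (n := 2 ^ (m0 + r)))/= ?expn_gt0 ?leq_exp2l ?addnS//.
  by rewrite -natr1 mulrDl mul1r lerD// block// leq_addr.
pose r := (Num.truncn (`|B| / eps)).+1.
exists (2 ^ (m0 + r)).-1; rewrite prednK ?expn_gt0//.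
apply: le_trans (many r).
rewrite -ler_pdivrMr// (le_trans _ (ltW (truncnS_gt _)))//.
by rewrite ler_pM2r ?invr_gt0// ler_norm.
Qed.

End regular_variation.

(** * The contradiction *)

Section tail_facts.
Context (R : realType) (F : probability R R).

Lemma tail_nonincreasing : {homo tail F : x y / x <= y >-> y <= x}.
Proof.
move=> x y xy; rewrite /tail fine_le ?fin_num_measure//.
apply: le_measure; rewrite ?inE//; apply: subset_itvr.
by rewrite bnd_simp.
Qed.

(** An atom of [F] at [l] is not large in comparison with the tail at [l]. *)
Lemma tail_closed_le (x0 : R) (r : R) : 0 < r ->
    (forall x, 0 < tail F x) ->
    (forall x, x0 <= x -> r * tail F x <= tail F (2 * x)) ->
  exists2 c : R, 0 < c & forall l, 0 < l ->
    c * fine (F `[l, +oo[%classic) <= tail F l.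
Proof.
move=> r0 tail_gt0 dbl.
exists (Num.min r (tail F (2 * x0))); first by rewrite lt_min r0 tail_gt0.
move=> l l0; have lE : l = 2 * (l / 2) by field.
have half : l / 2 < l by rewrite ltr_pdivrMr// ltr_pMr// ltr1n.
have F0 : 0 <= fine (F `[l, +oo[%classic) by exact: fine_ge0.
have [x0l|lx0] := leP x0 (l / 2).
  rewrite {2}lE; apply: le_trans (dbl _ x0l).
  apply: ler_pM => //; first by rewrite le_min !ltW.
    by rewrite ge_min lexx.
  rewrite /tail fine_le ?fin_num_measure//.
  apply: le_measure; rewrite ?inE//; apply: subset_itvr.
  by rewrite bnd_simp.
apply: (@le_trans _ _ (tail F (2 * x0) * 1)).
  apply: ler_pM => //; first by rewrite le_min !ltW.
    by rewrite ge_min lexx orbT.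
  by rewrite -lee_fin fineK ?fin_num_measure// probability_le1.
rewrite mulr1; apply: tail_nonincreasing; rewrite lE ler_pM2l//; exact: ltW.
Qed.

End tail_facts.

Section second_moment_vs_length.
Context (R : realType) (F : probability R R) (mu b : R) (a : assignment R).

Lemma Z2_ge0 k x : 0 <= Z2 F mu b a k x.
Proof. by rewrite /Z2 mulr_ge0// expR_ge0. Qed.

Lemma Z3_ge0 k x : 0 <= Z3 F mu b a k x.
Proof. by rewrite /Z3 !mulr_ge0 ?invr_ge0 ?tail_ge0. Qed.

(** The contribution of the first estimator to [Z]. *)
Definition Z1_part (w : outcome R (idx a)) : R :=
  let: existT k x := w in Z1 F mu b a k x.1.1 / (prob a k)%:num.

Lemma Z1_part_ge0 w : 0 <= Z1_part w.
Proof. by case: w => k x /=; rewrite divr_ge0// Z1_ge0. Qed.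

Lemma Z1_part_le_Z w : Z1_part w <= Z F mu b w.
Proof.
case: w => k [[x1 x2] x3] /=; rewrite ler_pM2r ?invr_gt0//.
by rewrite -addrA lerDl addr_ge0 ?Z2_ge0 ?Z3_ge0.
Qed.

Local Open Scope ereal_scope.

(** A Cauchy-Schwarz type trade-off between the second moment of [Z] and the mean of
    [nu], from the pointwise inequality [sqrt nu * Z1_part <= Z1_part ^ 2 + nu]. *)
Lemma sum_sqrt_Z1_le N :
  \sum_(k < N) (Num.sqrt (idx a k.+1)%:R)%:E *
     \int[law1 F mu b a k.+1]_x (Z1 F mu b a k.+1 x)%:E <=
  \int[Q F mu b a]_w ((Z F mu b w) ^+ 2)%:E +
  \int[Q F mu b a]_w ((nu w)%:R)%:E.
Proof.
pose g (w : outcome R (idx a)) : R := (Num.sqrt (nu w)%:R * Z1_part w)%R.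
have g0 w : (0 <= g w)%R by rewrite mulr_ge0// Z1_part_ge0.
have mZ1 : measurable_fun setT Z1_part.
  apply: measurable_outcome => k; apply: measurable_funM => //.
  exact: measurableT_comp (@measurable_Z1 _ F mu b a k) (@measurable_fst_fst _ a k).
have mnu : measurable_fun setT (fun w : outcome R (idx a) => (nu w)%:R : R).
  apply: measurable_outcome => k.
  by rewrite (_ : (fun x => _) = cst (idx a k)%:R).
have msnu : measurable_fun setT
    (fun w : outcome R (idx a) => Num.sqrt (nu w)%:R : R).
  apply: measurable_outcome => k.
  by rewrite (_ : (fun x => _) = cst (Num.sqrt (idx a k)%:R)).
have mg : measurable_fun setT (fun w => (g w)%:E).
  by apply/measurable_EFinP; exact: measurable_funM.
apply: (@le_trans _ _ (\int[Q F mu b a]_w (g w)%:E)).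
  apply: le_trans (integral_Q_ge F mu b N mg _) => [|w]; last by rewrite lee_fin.
  apply: lee_sum => k _; rewrite integral_law_given//=.
  have mh : measurable_fun setT
      (fun x : (idx a k.+1).-tuple R => (Z1 F mu b a k.+1 x)%:E).
    by apply/measurable_EFinP; exact: measurable_Z1.
  have c0 : (0 <= Num.sqrt (idx a k.+1)%:R / (prob a k.+1)%:num :> R)%R.
    by rewrite divr_ge0.
  rewrite (eq_integral (fun x : runs R (idx a k.+1) =>
    (Num.sqrt (idx a k.+1)%:R / (prob a k.+1)%:num)%:E *
      (Z1 F mu b a k.+1 x.1.1)%:E)); last first.
    by move=> x _; rewrite -EFinM /g/= mulrA mulrAC.
  rewrite ge0_integralZl//; last 2 first.
  - exact: measurableT_comp mh (@measurable_fst_fst _ a k.+1).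
  - by move=> x _; rewrite lee_fin Z1_ge0.
  rewrite (@integral_run_law_fst _ F mu b a k.+1 _ _ mh)//; last first.
    by move=> x; rewrite lee_fin Z1_ge0.
  by rewrite muleA -EFinM mulrCA divff ?mulr1// gt_eqF.
apply: (@le_trans _ _ (\int[Q F mu b a]_w
    ((Z1_part w ^+ 2)%:E + ((nu w)%:R)%:E))).
  apply: ge0_le_integralT => w; first by rewrite lee_fin.
  rewrite -EFinD lee_fin /g -[in leRHS](sqr_sqrtr (ler0n R (nu w))).
  have := sqr_ge0 (Num.sqrt (nu w)%:R - Z1_part w)%R.
  have := sqrtr_ge0 ((nu w)%:R : R); have := Z1_part_ge0 w.
  move: (Z1_part w) (Num.sqrt _) => z s z0 s0; nra.
rewrite ge0_integralD//; last 3 first.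
- by move=> w _; rewrite lee_fin sqr_ge0.
- by apply/measurable_EFinP; exact: measurable_funX.
- exact/measurable_EFinP.
apply: leeD2r; apply: ge0_le_integralT => w; rewrite lee_fin ?sqr_ge0//.
by rewrite ler_pXn2r ?nnegrE ?(le_trans (Z1_part_ge0 w)) ?Z1_part_le_Z ?Z1_part_ge0.
Qed.

End second_moment_vs_length.

Lemma sqrt_sum_le_sum_window (R : realType) (a : assignment R) (f : nat -> R) N :
    (forall i, 0 <= f i) ->
  \sum_(1 <= i < (idx a N).+1) Num.sqrt i%:R * f i <=
  \sum_(k < N) Num.sqrt (idx a k.+1)%:R *
    \sum_((idx a k).+1 <= i < (idx a k.+1).+1) f i.
Proof.
move=> f0; elim: N => [|N IHN]; first by rewrite idx0 big_geq// big_ord0.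
have lt : (idx a N < idx a N.+1)%N by exact: idx_incr.
rewrite big_ord_recr/= (big_cat_nat (n := (idx a N).+1))//=; last exact: ltnW.
rewrite lerD// mulr_sumr big_nat [leRHS]big_nat.
apply: ler_sum => i /andP[_ ihi].
by rewrite ler_wpM2r// ler_sqrt// ler_nat.
Qed.

Unset Implicit Arguments.

Theorem theorem5 (R : realType) (d : measure_display) (Omega : measurableType d)
    (P : probability Omega R) (X : {RV P >-> R}) (mu alpha : R) (L : R -> R)
    (X_integrable : P.-integrable setT (EFin \o X)) (X_mean : ('E_P[X] = 0)%E)
    (mu_gt0 : 0 < mu)
    (assumption1 : tail_assumption X alpha L)
    (assumption2 : smoothness_assumption L)
    (alpha_lt : alpha < 3%:R / 2%:R)
    (b : R) (b_gt0 : 0 < b) :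
  ~ exists a : assignment R,
      [/\ forall k, (0 < k)%N -> Lambda (distribution P X) mu b a k \is a fin_num,
          (\int[Q (distribution P X) mu b a]_w
              ((Z (distribution P X) mu b w) ^+ 2)%:E < +oo)%E
        & (\int[Q (distribution P X) mu b a]_w ((nu w)%:R)%:E < +oo)%E].
Proof.
move=> [a [_ second_moment_fin nu_fin]].
set F := distribution P X in second_moment_fin nu_fin.
have F_int : F.-integrable setT EFin.
  apply/integrableP; split => //.
  rewrite ge0_integral_distribution//; first by case/integrableP: X_integrable.
  by apply/measurable_EFinP; exact: normr_measurable.
have F_mean : (\int[F]_x x%:E = 0)%E.
  by rewrite integral_distribution// -X_mean unlock.
have [_ L_sv tailL _] := assumption1.
have tail_E x : 0 < x -> tail F x = x `^ (- alpha) * L x.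
  by move=> x0; rewrite [LHS](congr1 fine (tailL x x0)).
have [x0 [x0_gt0 tail_pos tail_dbl]] :=
  regular_variation_doubling alpha_lt L_sv (@tail_ge0 _ F) tail_E.
have tail_gt0 x : 0 < tail F x.
  apply: (lt_le_trans (tail_pos (Num.max x x0) _)).
    by rewrite le_max lexx orbT.
  by apply: tail_nonincreasing; rewrite le_max lexx.
have rhoV : 0 < (2 * Num.sqrt 2 : R)^-1 by rewrite invr_gt0 rho_gt0.
have [c c_gt0 tail_c] := tail_closed_le rhoV tail_gt0 tail_dbl.
have [C [delta [C_gt0 delta_gt0 stays_ge]]] :=
  stays_probability_ge mu_gt0 F_int F_mean.
have step k : ((c * delta * \sum_((idx a k).+1 <= i < (idx a k.+1).+1)
      tail F (b + i%:R * (C + mu)))%:E <=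
    \int[law1 F mu b a k.+1]_x (Z1 F mu b a k.+1 x)%:E)%E.
  apply: (le_trans _ (@integral_law1_Z1_ge R F mu b a k.+1 isT tail_gt0 c
    (ltW c_gt0) _)); last first.
    by move=> j; apply: tail_c; rewrite /level ltr_wpDr// mulr_ge0// ltW.
  rewrite -mulrA EFinM lee_wpmul2l//; first by rewrite lee_fin ltW.
  exact: (hits_probability_ge b_gt0 C_gt0 _ _ stays_ge).
have := @sum_sqrt_Z1_le R F mu b a.
have : (\int[Q F mu b a]_w ((Z F mu b w) ^+ 2)%:E +
    \int[Q F mu b a]_w ((nu w)%:R)%:E < +oo)%E by exact: lte_add_pinfty.
set S := (_ + _)%E => S_fin S_ge.
have S_ge0 : (0 <= S)%E.
  by apply: adde_ge0; apply: integral_ge0 => w _; rewrite lee_fin// sqr_ge0.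
have [B SB] : exists B, S = B%:E.
  by exists (fine S); rewrite fineK// ge0_fin_numE.
have D_gt0 : 0 < C + mu by rewrite addr_gt0.
(* [c * delta] times this sum exceeds [B], although [B] bounds it from above. *)
have [N N_big] := sqrt_weighted_sum_unbounded x0_gt0 b_gt0 D_gt0
  (tail_ge0 F) (@tail_nonincreasing _ F) tail_pos tail_dbl (B / (c * delta) + 1).
have idx_ge n : (n <= idx a n)%N.
  by elim: n => // n IHn; apply: leq_ltn_trans IHn _; exact: idx_incr.
pose f i := tail F (b + i%:R * (C + mu)).
have f_ge0 i : 0 <= f i by exact: tail_ge0.
have : B / (c * delta) + 1 <= \sum_(k < N) Num.sqrt (idx a k.+1)%:R *
    \sum_((idx a k).+1 <= i < (idx a k.+1).+1) f i.
  apply: le_trans (sqrt_sum_le_sum_window _ _ f_ge0).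
  apply: (@le_trans _ _ (\sum_(1 <= i < N.+1) Num.sqrt i%:R * f i)) => //.
  rewrite [leRHS](big_cat_nat (n := N.+1)) ?ltnS// lerDl sumr_ge0// => i _.
  by rewrite mulr_ge0.
apply/negP; rewrite -ltNge; apply: (@le_lt_trans _ _ (B / (c * delta))).
  rewrite ler_pdivlMr ?mulr_gt0// -lee_fin -SB; apply: le_trans (S_ge N).
  rewrite mulr_suml -sumEFin; apply: lee_sum => k _.
  rewrite -mulrA EFinM lee_wpmul2l ?lee_fin//.
  by rewrite mulrC; exact: step.
by rewrite ltrDl.
Qed.
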